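(* Let $w\colon[0,1]\times[0,1]\to[0,1]$ be a (not necessarily symmetric) graphon for which there is $d_0>0$ with $d_{\mathrm{out}}(x)\ge d_0$ for all $x\in[0,1]$, and let $p$ be its transition density function. Let $\mu$ be a strictly positive probability density on $[0,1]$ such that $\nu(x)=\int_0^1 p(y,x)\,\mu(y)\,\mathrm{d}y$ is strictly positive as well. Let $\mathcal{T}\colon L^2_\mu\to L^2_\nu$ be the reweighted Perron--Frobenius operator and $\mathcal{F}\colon L^2_\mu\to L^2_\mu$ the forward--backward operator. Since $\mathcal{F}$ is self-adjoint, it can be decomposed as $$\mathcal{F}=\sum_\ell\lambda_\ell\,(\varphi_\ell\otimes_\mu\varphi_\ell),$$ where $\varphi_\ell$ is the $\ell$th eigenfunction of $\mathcal{F}$ and $\lambda_\ell$ the associated nonzero eigenvalue. The operator $\mathcal{T}$ then has the singular value decomposition $$\mathcal{T}=\sum_\ell\sigma_\ell\,(u_\ell\otimes_\mu v_\ell),\qquad \sigma_\ell=\lambda_\ell^{1/2},\quad u_\ell=\lambda_\ell^{-1/2}\,\mathcal{T}\varphi_\ell,\quad v_\ell=\varphi_\ell,$$ and the transition density function can be written as $$p(x,y)=\sum_\ell\sigma_\ell\,v_\ell(x)\,u_\ell(y)\,\nu(y).$$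
   Context: A graphon is a Lebesgue-measurable function $w\colon[0,1]\times[0,1]\to[0,1]$. Its out-degree function is $d_{\mathrm{out}}(x)=\int_0^1 w(x,y)\,\mathrm{d}y$ and its transition density function is $p(x,y)=w(x,y)/d_{\mathrm{out}}(x)$. For a probability density $\mu$ on $[0,1]$, $L^2_\mu$ is the Hilbert space of (equivalence classes of) functions $f$ with $\int_0^1|f(x)|^2\mu(x)\,\mathrm{d}x<\infty$ and inner product $\langle f,g\rangle_\mu=\int_0^1 f(x)g(x)\mu(x)\,\mathrm{d}x$. The rank-one operator $s\otimes_\mu r$ is defined by $(s\otimes_\mu r)f=\langle r,f\rangle_\mu\,s$. The Koopman operator $\mathcal{K}\colon L^2_\nu\to L^2_\mu$ is $\mathcal{K}f(x)=\int_0^1 p(x,y)f(y)\,\mathrm{d}y$. The reweighted Perron--Frobenius operator $\mathcal{T}\colon L^2_\mu\to L^2_\nu$ is $\mathcal{T}u(x)=\frac{1}{\nu(x)}\int_0^1 p(y,x)\,\mu(y)\,u(y)\,\mathrm{d}y$. The forward--backward operator is $\mathcal{F}=\mathcal{K}\mathcal{T}\colon L^2_\mu\to L^2_\mu$, i.e. $\mathcal{F}u(x)=\int_0^1 p(x,y)\frac{1}{\nu(y)}\int_0^1 p(z,y)\,\mu(z)\,u(z)\,\mathrm{d}z\,\mathrm{d}y$; it satisfies $\langle\mathcal{F}u,v\rangle_\mu=\langle u,\mathcal{F}v\rangle_\mu$ and $\langle\mathcal{F}u,u\rangle_\mu\ge 0$. In an eigendecomposition the $\varphi_\ell$ form an orthonormal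 system (here in $L^2_\mu$) belonging to the nonzero eigenvalues; in a singular value decomposition the left singular functions $u_\ell$ (here in $L^2_\nu$) and the right singular functions $v_\ell$ (here in $L^2_\mu$) form orthonormal systems belonging to the positive singular values $\sigma_\ell$. *)

(* Defs.v *)
From HB Require Import structures.
From mathcomp Require Import all_boot all_order all_algebra.
From mathcomp Require Import all_classical all_reals all_analysis.
From mathcomp Require Import measurable_realfun.
Set Implicit Arguments.
Unset Strict Implicit.
Unset Printing Implicit Defensive.
Import Order.TTheory GRing.Theory Num.Theory.
Import numFieldNormedType.Exports.

Local Open Scope classical_set_scope.
Local Open Scope ring_scope.

(* Functions on [0,1] (resp. [0,1]^2) are represented by total functions
   R -> R (resp. R -> R -> R) of which only the values on [0,1] matter.

   The sigma-algebra carried by R in the library is the Borel one.  Lebesgue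
   measurability is measurability for its completion, i.e. every preimage of
   a Borel set is the union of a Borel set and a negligible set.  The library
   integral is a supremum over (Borel) simple functions, for f^+ and f^-
   separately, so on such functions it is the Lebesgue integral. *)
Definition completed_measurable_fun d (T : measurableType d) (R : realType)
    (m : {measure set T -> \bar R}) (D : set T) (f : T -> R) : Prop :=
  forall B : set R, measurable B ->
    completed_algebra_gen m (D `&` f @^-1` B).

Section definitions.
Context {R : realType}.

Notation leb := (@lebesgue_measure R).
Notation unitI := (`[0%R, 1%R]%classic : set R).
Notation leb2 := (@lebesgue_measure R \x @lebesgue_measure R)%E.

Implicit Types (w : R -> R -> R) (mu nu f g r s : R -> R).

Definition graphon w : Prop :=
  completed_measurable_fun leb2 (unitI `*` unitI) (fun z => w z.1 z.2) /\
  (forall x y, x \in unitI -> y \in unitI -> 0 <= w x y <= 1).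

Definition out_degree w (x : R) : R := \int[leb]_(y in unitI) w x y.

Definition transition_density w (x y : R) : R := w x y / out_degree w x.

Definition probability_density mu : Prop :=
  [/\ completed_measurable_fun leb unitI mu,
      (forall x, x \in unitI -> 0 <= mu x) &
      (\int[leb]_(x in unitI) (mu x)%:E = 1)%E].

Definition image_density w mu (x : R) : R :=
  \int[leb]_(y in unitI) (transition_density w y x * mu y).

Definition inner mu f g : R := \int[leb]_(x in unitI) (f x * g x * mu x).

Definition sqnorm mu f : \bar R :=
  (\int[leb]_(x in unitI) (f x ^+ 2 * mu x)%:E)%E.

(* Members of L^2_mu are handled through their representatives; every notion
   below depends only on the classes modulo almost everywhere equality. *)
Definition L2 mu f : Prop :=
  completed_measurable_fun leb unitI f /\ (sqnorm mu f < +oo)%E.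

Definition rank_one mu s r : (R -> R) -> R -> R :=
  fun f x => inner mu r f * s x.

Definition koopman w : (R -> R) -> R -> R :=
  fun f x => \int[leb]_(y in unitI) (transition_density w x y * f y).

Definition perron_frobenius w mu : (R -> R) -> R -> R :=
  fun u x => (image_density w mu x)^-1 *
             \int[leb]_(y in unitI) (transition_density w y x * mu y * u y).

Definition forward_backward w mu : (R -> R) -> R -> R :=
  koopman w \o perron_frobenius w mu.

(* The operator norm of A : L^2_mu -> L^2_nu is at most c (for 0 <= c). *)
Definition opnorm_le mu nu (A : (R -> R) -> R -> R) (c : R) : Prop :=
  forall f, L2 mu f -> (sqnorm nu (A f) <= (c ^+ 2)%:E * sqnorm mu f)%E.

(* A = \sum_(l in I) c_l (s_l (x)_mu r_l) as operators L^2_mu -> L^2_nu, the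
   series converging in operator norm.  The index set I is a subset of nat,
   so that finite and infinite families are covered at once. *)
Definition operator_series mu nu (A : (R -> R) -> R -> R)
    (I : set nat) (c : nat -> R) (s r : nat -> R -> R) : Prop :=
  (forall f, L2 mu f -> L2 nu (A f)) /\
  (forall eps : R, 0 < eps -> \forall n \near \oo,
     opnorm_le mu nu
       (fun f x => A f x -
          \sum_(0 <= l < n | l \in I) c l * rank_one mu (s l) (r l) f x)
       eps).

Definition orthonormal_system mu (I : set nat) (e : nat -> R -> R) : Prop :=
  (forall l, I l -> L2 mu (e l)) /\
  (forall k l, I k -> I l -> inner mu (e k) (e l) = (k == l)%:R).

Definition eigendecomposition mu (A : (R -> R) -> R -> R)
    (I : set nat) (lambda : nat -> R) (phi : nat -> R -> R) : Prop :=
  [/\ orthonormal_system mu I phi,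
      (forall l, I l -> lambda l != 0),
      (forall l, I l ->
         ae_eq leb unitI (A (phi l)) (fun x => lambda l * phi l x)) &
      operator_series mu mu A I lambda phi phi].

Definition singular_value_decomposition mu nu (A : (R -> R) -> R -> R)
    (I : set nat) (sigma : nat -> R) (u v : nat -> R -> R) : Prop :=
  [/\ orthonormal_system nu I u,
      orthonormal_system mu I v,
      (forall l, I l -> 0 < sigma l) &
      operator_series mu nu A I sigma u v].

(* p(x,y) = \sum_(l in I) sigma_l v_l(x) u_l(y) nu(y), the series of kernels
   p(x,y)/nu(y) = \sum_l sigma_l v_l(x) u_l(y) converging in L^2([0,1]^2) for
   the density mu(x) nu(y); clearing the denominator nu(y)^2 in the squared
   norm turns this density into mu(x)/nu(y). *)
Definition kernel_series mu nu (p : R -> R -> R)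
    (I : set nat) (sigma : nat -> R) (u v : nat -> R -> R) : Prop :=
  (fun n : nat => \int[leb2]_(z in unitI `*` unitI)
     ((p z.1 z.2 -
        \sum_(0 <= l < n | l \in I) sigma l * v l z.1 * u l z.2 * nu z.2) ^+ 2
      * (mu z.1 / nu z.2))%:E)%E @ \oo --> 0%E.

End definitions.

(* Main.v *)
Require Import Defs.
From mathcomp Require Import all_boot all_order all_algebra.
From mathcomp Require Import all_classical all_reals all_analysis.
From mathcomp Require Import measurable_realfun.
From mathcomp Require Import ring lra.
Set Implicit Arguments.
Unset Strict Implicit.
Unset Printing Implicit Defensive.
Import Order.TTheory GRing.Theory Num.Theory.
Import numFieldNormedType.Exports.
Local Open Scope classical_set_scope.
Local Open Scope ring_scope.

(** Multiplication by the square root of the weight maps L^2_mu and L^2_nu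
    isometrically onto the functions of the unweighted L^2(R) that vanish off
    [0, 1].  It turns T into the integral operator with kernel
    K(x, y) = p(x, y) sqrt(mu(x)) / sqrt(nu(y)) and F into its Gram operator.
    Since p <= 1/d0 and nu is the image of mu, K is square integrable, so T is
    Hilbert-Schmidt: the sum of |T e_l|^2 over any finite orthonormal family is
    at most |K|^2.  This makes the Gram operator A compact, and successive
    maximisation of <A f, f> on orthogonal complements yields eigenfunctions
    with eigenvalues lambda_n <= |K|^2 / (n + 1).

    If A = sum lambda_l phi_l (x) phi_l and g is the component of f orthogonal
    to the first n eigenfunctions, then |T g|^2 = <A g, g> and A g is the
    remainder of A f, so the singular value expansion of T converges in operator
    norm.  The remainders K - sum_(l < n) phi_l (x) T phi_l are Cauchy in
    L^2(R^2); their limit is orthogonal to every product f(x) g(y), hence zero. *)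

(** * Semi-inner products *)

(** Square integrability of the kernel comes from K^2 <= p mu / (d0 nu): integrating p(x, y) mu(x)
    in x gives back nu(y), so |K|^2 <= 1/d0. The limit kernel is orthogonal to products because
    pairing a kernel with f(x) g(y) is the same as pairing its operator applied to f with g, and the
    vector remainders of T f tend to zero. The singular value statement starts from an arbitrary
    eigendecomposition, in any order and with no rate of convergence. It therefore uses nothing of
    the constructed one: positivity of the eigenvalues and both expansions are derived from the
    given system. Two obstacles shape the set-up. Members of L^2 are functions rather than classes,
    so inner products are only semidefinite, and vectors are compared by pairing them with all
    others. The data are measurable for the completed sigma-algebra while the product and Tonelli
    arguments are Borel, so each datum is replaced by a Borel version and null sets are carried
    along. *)

Definition semi_inner (R : realType) (V : lmodType R) (ip : V -> V -> R) :=
  [/\ (forall f g, ip f g = ip g f),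
      (forall a f g h, ip (a *: f + g) h = a * ip f h + ip g h) &
      (forall f, 0 <= ip f f)].

Definition orthonormal_on (R : realType) (V : lmodType R) (ip : V -> V -> R)
    (I : eqType) (r : seq I) (e : I -> V) :=
  forall k l, k \in r -> l \in r -> ip (e k) (e l) = (k == l)%:R.

Section semi_inner_theory.
Context (R : realType) (V : lmodType R) (ip : V -> V -> R).
Hypothesis ipH : semi_inner ip.
Implicit Types f g h : V.

Lemma ipC f g : ip f g = ip g f. Proof. by case: ipH. Qed.

Lemma ip_ge0 f : 0 <= ip f f. Proof. by case: ipH. Qed.

Lemma ipPl a f g h : ip (a *: f + g) h = a * ip f h + ip g h.
Proof. by case: ipH. Qed.

Lemma ip0l h : ip 0 h = 0.
Proof. by have := ipPl 1 0 0 h; rewrite scaler0 addr0; lra. Qed.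

Lemma ipDl f g h : ip (f + g) h = ip f h + ip g h.
Proof. by rewrite -[f]scale1r ipPl mul1r scale1r. Qed.

Lemma ipZl a f h : ip (a *: f) h = a * ip f h.
Proof. by rewrite -[a *: f]addr0 ipPl ip0l addr0. Qed.

Lemma ipNl f h : ip (- f) h = - ip f h.
Proof. by rewrite -scaleN1r ipZl mulN1r. Qed.

Lemma ipBl f g h : ip (f - g) h = ip f h - ip g h.
Proof. by rewrite ipDl ipNl. Qed.

Lemma ip0r h : ip h 0 = 0. Proof. by rewrite ipC ip0l. Qed.

Lemma ipDr f g h : ip h (f + g) = ip h f + ip h g.
Proof. by rewrite ipC ipDl !(ipC h). Qed.

Lemma ipZr a f h : ip h (a *: f) = a * ip h f.
Proof. by rewrite ipC ipZl ipC. Qed.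

Lemma ipNr f h : ip h (- f) = - ip h f.
Proof. by rewrite ipC ipNl ipC. Qed.

Lemma ipBr f g h : ip h (f - g) = ip h f - ip h g.
Proof. by rewrite ipDr ipNr. Qed.

Lemma ip_suml I (r : seq I) (P : pred I) (F : I -> V) h :
  ip (\sum_(l <- r | P l) F l) h = \sum_(l <- r | P l) ip (F l) h.
Proof. by elim/big_rec2: _ => [|l x y _ <-]; rewrite ?ip0l ?ipDl. Qed.

Lemma ip_sumr I (r : seq I) (P : pred I) (F : I -> V) h :
  ip h (\sum_(l <- r | P l) F l) = \sum_(l <- r | P l) ip h (F l).
Proof. by rewrite ipC ip_suml; apply: eq_bigr => l _; rewrite ipC. Qed.

Lemma ip_CS f g : ip f g ^+ 2 <= ip f f * ip g g.
Proof.
have E t : 0 <= t ^+ 2 * ip f f + 2 * t * ip f g + ip g g.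
  have := ip_ge0 (t *: f + g).
  by rewrite !(ipDl, ipDr, ipZl, ipZr) (ipC g f); congr (0 <= _); ring.
have [a0|a0] := eqVneq (ip f f) 0; last first.
  have a_gt0 : 0 < ip f f by rewrite lt_def a0 ip_ge0.
  have := E (- ip f g / ip f f).
  set t := _ / _; have tE : t * ip f f = - ip f g by rewrite /t divfK.
  move=> h; have : 0 <= ip f f * (t ^+ 2 * ip f f + 2 * t * ip f g + ip g g).
    by rewrite mulr_ge0 // ip_ge0.
  have -> : ip f f * (t ^+ 2 * ip f f + 2 * t * ip f g + ip g g) =
    (t * ip f f) ^+ 2 + 2 * (t * ip f f) * ip f g + ip f f * ip g g by ring.
  by rewrite tE; nra.
(* Here the quadratic is affine in [t]; were [ip f g] nonzero, the chosen [t] would give it the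
   value -1. *)
rewrite a0 mul0r; have [->|b0] := eqVneq (ip f g) 0; first by rewrite expr0n.
have := E (- (ip g g + 1) / (2 * ip f g)); rewrite a0 mulr0 add0r.
have -> : 2 * (- (ip g g + 1) / (2 * ip f g)) * ip f g = - (ip g g + 1).
  by field.
lra.
Qed.

(** Stands in for definiteness: a vector of seminorm zero is invisible to every pairing. *)
Lemma ip_null f g : ip f f = 0 -> ip f g = 0.
Proof.
move=> f0; have := ip_CS f g; rewrite f0 mul0r => h.
by apply/eqP; rewrite -sqrf_eq0 eq_le h sqr_ge0.
Qed.

Lemma ip_eq f g : (forall h, ip f h = ip g h) -> ip f f = ip g g.
Proof. by move=> E; rewrite E ipC E. Qed.

Lemma ip_sqnormB f g : ip (f - g) (f - g) = ip f f - 2 * ip f g + ip g g.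
Proof. rewrite !(ipBl, ipBr) (ipC g f); ring. Qed.

Lemma ip_pythagoras f g : ip f g = ip g g -> ip (g - f) (g - f) = ip f f - ip g g.
Proof. move=> fg; rewrite ip_sqnormB (ipC g) fg; ring. Qed.

Lemma ip_le2D f g : ip (f + g) (f + g) <= 2 * ip f f + 2 * ip g g.
Proof.
have := ip_ge0 (f - g); rewrite !(ipBl, ipBr, ipDl, ipDr) (ipC g f); lra.
Qed.

Section orthonormal_family.
Context (I : eqType) (r : seq I) (e : I -> V).
Hypotheses (r_uniq : uniq r) (eON : orthonormal_on ip r e).

Definition proj f := \sum_(l <- r) ip (e l) f *: e l.

Lemma sum_kronecker (c : I -> R) k : k \in r ->
  \sum_(l <- r) c l * ip (e l) (e k) = c k.
Proof.
move=> kr; rewrite (big_rem k) //= eON // eqxx mulr1 big_seq big1 ?addr0 // => l.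
by rewrite mem_rem_uniq // inE => /andP[lk lr]; rewrite eON // (negPf lk) mulr0.
Qed.

Lemma ip_proj k f : k \in r -> ip (e k) (proj f) = ip (e k) f.
Proof.
move=> kr; rewrite ipC ip_suml.
under eq_bigr do rewrite ipZl.
by rewrite (sum_kronecker (fun l => ip (e l) f)).
Qed.

Lemma proj_orth k f : k \in r -> ip (e k) (f - proj f) = 0.
Proof. by move=> kr; rewrite ipBr ip_proj // subrr. Qed.

Lemma proj_sqnorm f :
  ip (f - proj f) (f - proj f) = ip f f - \sum_(l <- r) ip (e l) f ^+ 2.
Proof.
rewrite ipBl; have -> : ip (proj f) (f - proj f) = 0.
  by rewrite ip_suml big_seq big1 // => l lr; rewrite ipZl proj_orth ?mulr0.
rewrite subr0 ipBr; congr (_ - _); rewrite ipC ip_suml.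
by apply: eq_bigr => l _; rewrite ipZl expr2.
Qed.

Lemma sqnorm_proj f : ip (proj f) (proj f) = \sum_(l <- r) ip (e l) f ^+ 2.
Proof.
rewrite {1}/proj ip_suml big_seq [RHS]big_seq.
by apply: eq_bigr => l lr; rewrite ipZl ip_proj // expr2.
Qed.

Lemma proj_compl_le f : ip (f - proj f) (f - proj f) <= ip f f.
Proof.
rewrite proj_sqnorm gerBl; apply: sumr_ge0 => l _; exact: sqr_ge0.
Qed.

End orthonormal_family.
End semi_inner_theory.

(* Completeness is only needed for sequences that converge at a prescribed
   geometric rate, which subsequences provide. *)
Definition rate_complete (R : realType) (V : lmodType R) (ip : V -> V -> R) :=
  forall h : nat -> V,
    (forall i j, (i <= j)%N -> ip (h j - h i) (h j - h i) <= 16^-1 ^+ i) ->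
    exists h0, forall i, ip (h0 - h i) (h0 - h i) <= 16^-1 ^+ i.

(** * Hilbert-Schmidt operators *)

Lemma fmap_ultra (S S' : Type) (f : S -> S') (U : set_system S) :
  UltraFilter U -> UltraFilter (fmap f U).
Proof.
move=> UU; split; first exact: fmap_proper_filter.
move=> G GP FG; apply/seteqP; split=> // A GA.
have [//|UnA] := @in_ultra_setVsetC _ U (f @^-1` A) UU.
by have [x []] := filter_ex (filterI GA (FG (~` A) UnA)).
Qed.

Lemma filter_forall_lt (S : Type) (U : set_system S) (A : nat -> set S) n :
  Filter U -> (forall l, U (A l)) -> U [set x | forall l, (l < n)%N -> A l x].
Proof.
move=> FU UA; elim: n => [|n IHn]; first by apply: filterS filterT.
apply: filterS (filterI IHn (UA n)) => x [Ax Anx] l.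
by rewrite ltnS leq_eqVlt => /predU1P[->//|]; exact: Ax.
Qed.

(** Compactness of [-M, M] gives the image ultrafilter a limit; the preimage of the ball of radius
    [delta / 2] around it serves as [S]. *)
Lemma ultra_bounded_cauchy (R : realType) (U : set_system nat) (M : R)
    (a : nat -> R) (delta : R) : UltraFilter U -> (forall n, `|a n| <= M) ->
  0 < delta -> exists2 S, U S & forall n m, S n -> S m -> `|a n - a m| <= delta.
Proof.
move=> UU aM d0; have UaU := fmap_ultra a UU.
have := @segment_compact R (- M) M; rewrite compact_ultra => /(_ _ UaU).
case=> [|l [_ al]].
  by rewrite fmapE; apply: nearW => n; rewrite /= in_itv /= -ler_norml.
have d20 : 0 < delta / 2 by rewrite divr_gt0.
exists (a @^-1` ball l (delta / 2)).
  by apply: al; exact: nbhsx_ballx.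
move=> n m; rewrite /ball /= => ln lm.
rewrite (_ : a n - a m = (l - a m) - (l - a n)); last by ring.
by rewrite (le_trans (ler_normB _ _)) // (splitr delta) lerD // ltW.
Qed.

Section hilbert_schmidt.
Context (R : realType) (V W : lmodType R).
Context (ipV : V -> V -> R) (ipW : W -> W -> R) (T : V -> W) (Ts : W -> V) (C : R).
Hypotheses (ipVH : semi_inner ipV) (ipWH : semi_inner ipW).
Hypothesis adj : forall f g, ipW (T f) g = ipV f (Ts g).
Hypothesis HS : forall (r : seq nat) e, uniq r -> orthonormal_on ipV r e ->
  \sum_(l <- r) ipW (T (e l)) (T (e l)) <= C.

Definition gram f := Ts (T f).

Lemma HS_bound_ge0 : 0 <= C.
Proof. by have := @HS [::] (fun=> 0) isT (fun _ _ h => False_ind _ (notF h)); rewrite big_nil. Qed.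

(** [T] is a mere function; having an adjoint makes it linear after pairing with any vector. *)
Lemma T_Pl a f g h : ipW (T (a *: f + g)) h = a * ipW (T f) h + ipW (T g) h.
Proof. by rewrite !adj (ipPl ipVH). Qed.

Lemma gramE f g : ipV (gram f) g = ipW (T f) (T g).
Proof. by rewrite (ipC ipVH) -adj (ipC ipWH). Qed.

Lemma gram_sym f g : ipV (gram f) g = ipV f (gram g).
Proof. by rewrite gramE (ipC ipWH) -gramE (ipC ipVH). Qed.

(** Makes Cauchy-Schwarz and the other semi-inner product rules available for the form of the Gram
    operator. *)
Lemma form_semi_inner : semi_inner (fun f g => ipW (T f) (T g)).
Proof.
by split=> [f g|a f g h|f]; [exact: ipC|exact: T_Pl|exact: ip_ge0].
Qed.

(** The Hilbert-Schmidt bound for the one-element family consisting of [f] normalised. *)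
Lemma T_bound f : ipW (T f) (T f) <= C * ipV f f.
Proof.
have [f0|f0] := eqVneq (ipV f f) 0.
  by rewrite adj (ip_null ipVH) // f0 mulr0.
have f_gt0 : 0 < ipV f f by rewrite lt_def f0 (ip_ge0 ipVH).
pose c := (Num.sqrt (ipV f f))^-1.
have c2 : c ^+ 2 = (ipV f f)^-1 by rewrite exprVn sqr_sqrtr // ltW.
have FH := form_semi_inner.
have := @HS [:: 0%N] (fun=> c *: f) isT.
rewrite big_seq1 (ipZl FH) (ipZr FH) mulrA -expr2 c2 mulrC ler_pdivrMr //; apply.
move=> k l; rewrite !inE => /eqP -> /eqP ->.
by rewrite (ipZl ipVH) (ipZr ipVH) mulrA -expr2 c2 mulVf ?eqxx.
Qed.

(** The squared norm of [Ts h] equals [ipW (T (Ts h)) h]; Cauchy-Schwarz and [T_bound] bound its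
    square by [C] times itself times [ipW h h], and one factor cancels. *)
Lemma Ts_bound h : ipV (Ts h) (Ts h) <= C * ipW h h.
Proof.
have := ip_CS ipWH (T (Ts h)) h; rewrite adj.
have := T_bound (Ts h); have := ip_ge0 ipWH h; have := ip_ge0 ipVH (Ts h).
have := HS_bound_ge0.
move: (ipV (Ts h) (Ts h)) (ipW h h) (ipW (T (Ts h)) (T (Ts h))) => x y z C0 x0 y0 zx xz.
have [->|xn0] := eqVneq x 0; first exact: mulr_ge0.
have : x * x <= x * (C * y).
  by rewrite -expr2 (le_trans xz) // mulrCA mulrA ler_wpM2r.
by rewrite ler_pM2l // lt_def xn0.
Qed.

(* Otherwise one could extend orthonormal families forever, each new vector
   adding at least eps to a sum that is bounded by C. *)
Lemma T_small_off_finite (eps : R) : 0 < eps ->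
  exists (n : nat) (e : nat -> V), orthonormal_on ipV (iota 0 n) e /\
    forall g, (forall l, (l < n)%N -> ipV (e l) g = 0) ->
      ipW (T g) (T g) <= eps * ipV g g.
Proof.
move=> eps0; apply: contrapT => noN.
have ext n : exists e : nat -> V, orthonormal_on ipV (iota 0 n) e /\
    forall l, (l < n)%N -> eps <= ipW (T (e l)) (T (e l)).
  elim: n => [|n [e [eON eT]]]; first by exists (fun=> 0); split.
  have [g ge0 gT] : exists2 g, (forall l, (l < n)%N -> ipV (e l) g = 0) &
      eps * ipV g g < ipW (T g) (T g).
    apply: contrapT => h; apply: noN; exists n, e; split=> // g ge0.
    by rewrite leNgt; apply/negP => gT; apply: h; exists g.
  have g_gt0 : 0 < ipV g g.
    rewrite lt_def (ip_ge0 ipVH) andbT; apply/eqP => g0.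
    by move: gT; rewrite g0 mulr0 adj (ip_null ipVH) // ltxx.
  pose c := (Num.sqrt (ipV g g))^-1.
  have c2 : c ^+ 2 = (ipV g g)^-1 by rewrite exprVn sqr_sqrtr // ltW.
  have FH := form_semi_inner.
  exists (fun l => if l == n then c *: g else e l); split=> [k l|l].
    rewrite !mem_iota !add0n !ltnS /= (leq_eqVlt k) (leq_eqVlt l).
    have [->|kn]/= := eqVneq k n; have [->|ln] //= := eqVneq l n.
    - by rewrite (ipZl ipVH) (ipZr ipVH) mulrA -expr2 c2 mulVf ?gt_eqF.
    - by move=> _ lln; rewrite (ipZl ipVH) (ipC ipVH) ge0 // mulr0.
    - by move=> kln _; rewrite (ipZr ipVH) ge0 // mulr0 (negPf kn).
    - by move=> kln lln; rewrite eON // mem_iota.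
  rewrite ltnS leq_eqVlt; have [->|ln] /= := eqVneq l n; last exact: eT.
  by rewrite (ipZl FH) (ipZr FH) mulrA -expr2 c2 mulrC ler_pdivlMr // ltW.
pose n := (Num.bound (C / eps)).
have [e [eON eT]] := ext n.
have := HS (iota_uniq 0 n) eON; apply/negP; rewrite -ltNge.
apply: (@lt_le_trans _ _ (\sum_(l <- iota 0 n) eps)).
  rewrite big_const_seq count_predT size_iota iter_addr_0 -mulr_natr mulrC.
  by rewrite -ltr_pdivrMr // archi_boundP // divr_ge0 ?HS_bound_ge0 // ltW.
rewrite big_seq [leRHS]big_seq; apply: ler_sum => l.
by rewrite mem_iota => /andP[_]; exact: eT.
Qed.

(* Along an ultrafilter all inner products with a finite orthonormal family
   converge, and off such families the operator is small. *)
Lemma gram_cauchy_subseq (g : nat -> V) : (forall n, ipV (g n) (g n) <= 1) ->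
  exists k : nat -> nat, (forall i, (i <= k i)%N) /\
    forall i j, (i <= j)%N ->
      ipV (gram (g (k j)) - gram (g (k i))) (gram (g (k j)) - gram (g (k i)))
        <= 16^-1 ^+ i.
Proof.
move=> g1; have C0 := HS_bound_ge0.
have [U [UU Uoo]] := ultraFilterLemma (eventually_filter).
(* Differences have squared norm at most 4, so [eta / 16] off the family gives [eta / 4]. Together
   with [eta / 4] for the projection and the factor 2 of [ip_le2D] this makes [eta]. *)
have TU (eta : R) : 0 < eta -> exists2 S, U S & forall n m, S n -> S m ->
    ipW (T (g n - g m)) (T (g n - g m)) <= eta.
  move=> eta0; have [N [e [eON eT]]] := T_small_off_finite (divr_gt0 eta0 (ltr0n R 16)).
  have d4 n m : ipV (g n - g m) (g n - g m) <= 4.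
    rewrite (le_trans (ip_le2D ipVH _ _)) // (ipNl ipVH) (ipNr ipVH) opprK.
    by have := g1 n; have := g1 m; lra.
  (* Chosen so that [C] times [N] squared coefficients is at most [eta / 4]; [C + 1] and [N.+1] keep
     the denominator positive. *)
  pose delta := Num.sqrt (eta / (4 * (C + 1) * (N.+1)%:R)).
  have delta0 : 0 < delta.
    by rewrite sqrtr_gt0 divr_gt0 // !mulr_gt0 // ltr_wpDl.
  have [S US HSd] : exists2 S, U S & forall l n m, (l < N)%N -> S n -> S m ->
      `|ipV (e l) (g n) - ipV (e l) (g m)| <= delta.
    have : forall l, exists S, U S /\ forall n m, (l < N)%N -> S n -> S m ->
        `|ipV (e l) (g n) - ipV (e l) (g m)| <= delta.
      move=> l; case: (ltnP l N) => lN; last first.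
        by exists setT; split=> [|//]; exact: filterT.
      have [n|S US HSd] := @ultra_bounded_cauchy R U 1 (fun n => ipV (e l) (g n)) delta UU _ delta0.
        rewrite -(@ler_pXn2r _ 2) ?nnegrE // real_normK ?num_real // expr1n.
        rewrite (le_trans (ip_CS ipVH _ _)) // eON ?mem_iota // eqxx mul1r.
        exact: g1.
      by exists S; split=> // n m _; exact: HSd.
    move=> /choice[S HSd].
    exists [set x | forall l, (l < N)%N -> S l x].
      by apply: filter_forall_lt => l; exact: (HSd l).1.
    by move=> l n m lN Sn Sm; apply: (HSd l).2 => //; [exact: Sn|exact: Sm].
  exists S => // n m Sn Sm; set d := g n - g m.
  pose P := proj ipV (iota 0 N) e d.
  have dP : ipW (T (d - P)) (T (d - P)) <= eta / 4.
    apply: (le_trans (eT _ _)) => [l lN|].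
      by rewrite (proj_orth ipVH) ?iota_uniq // mem_iota.
    have := proj_compl_le ipVH (iota_uniq 0 N) eON d; rewrite -/P.
    by have := d4 n m; rewrite -/d; nra.
  have PP : ipW (T P) (T P) <= eta / 4.
    rewrite (le_trans (T_bound _)) // (sqnorm_proj ipVH) ?iota_uniq //.
    have : \sum_(l <- iota 0 N) ipV (e l) d ^+ 2 <= \sum_(l <- iota 0 N) delta ^+ 2.
      rewrite big_seq [leRHS]big_seq; apply: ler_sum => l.
      rewrite mem_iota => /andP[_ lN].
      rewrite -[leLHS]real_normK ?num_real // ler_pXn2r ?nnegrE //; last exact: ltW.
      by rewrite /d (ipBr ipVH); exact: HSd.
    rewrite big_const_seq count_predT size_iota iter_addr_0.
    rewrite sqr_sqrtr; last by rewrite divr_ge0 ?ltW // !mulr_gt0 // ltr_wpDl.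
    move=> /(ler_wpM2l C0) /le_trans; apply.
    have C10 : 0 < C + 1 by rewrite ltr_wpDl.
    have N0 : 0 < N.+1%:R :> R by rewrite ltr0n.
    rewrite -[_ *+ N]mulr_natr.
    have -> : C * (eta / (4 * (C + 1) * N.+1%:R) * N%:R) =
        eta / 4 * (C / (C + 1) * (N%:R / N.+1%:R)).
      by field; rewrite !gt_eqF.
    apply: ler_piMr; first by rewrite divr_ge0 // ltW.
    apply: mulr_ile1.
    - by rewrite divr_ge0 // ltW.
    - by rewrite divr_ge0.
    - by rewrite ler_pdivrMr // mul1r lerDl.
    - by rewrite ler_pdivrMr // mul1r ler_nat.
  have FH := form_semi_inner.
  have := ip_le2D FH (d - P) P; rewrite /= subrK; lra.
(* Dividing by [C + 1] absorbs the constant of [Ts_bound] when passing from [T] to [gram]. *)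
have /choice[S HSc] : forall i, exists S, U S /\ forall n m, S n -> S m ->
    ipW (T (g n - g m)) (T (g n - g m)) <= 16^-1 ^+ i / (C + 1).
  move=> i; have [|S US H] := TU (16^-1 ^+ i / (C + 1)).
    by rewrite divr_gt0 ?exprn_gt0 // ltr_wpDl.
  by exists S.
(* Taking [k i] in all of [S 0], ..., [S i] puts every later [k j] in [S i] too; [i <= n] is
   possible because [U] refines the filter at infinity. *)
have /choice[k Hk] : forall i, exists n, (i <= n)%N /\ forall j, (j <= i)%N -> S j n.
  move=> i.
  have [n [ni nS]] : exists n, ([set n | (i <= n)%N] `&`
      [set n | forall j, (j < i.+1)%N -> S j n]) n.
    apply: (@filter_ex _ U); apply: filterI.
      by apply: Uoo; exists i => // n /=.
    by apply: filter_forall_lt => l; exact: (HSc l).1.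
  by exists n; split=> // j ji; apply: nS.
exists k; split=> [i|i j ij]; first exact: (Hk i).1.
have := (HSc i).2 (k j) (k i) ((Hk j).2 i ij) ((Hk i).2 i (leqnn i)).
set d := g (k j) - g (k i) => dS.
have -> : ipV (gram (g (k j)) - gram (g (k i))) (gram (g (k j)) - gram (g (k i)))
   = ipV (gram d) (gram d).
  by apply: (ip_eq ipVH) => h; rewrite (ipBl ipVH) !gram_sym /d (ipBl ipVH).
rewrite (le_trans (Ts_bound _)) //.
have C10 : 0 < C + 1 by rewrite ltr_wpDl.
move: dS; rewrite ler_pdivlMr // => dS.
apply: le_trans dS; rewrite mulrC ler_wpM2l ?(ip_ge0 ipWH) // lerDl.
by [].
Qed.

End hilbert_schmidt.

(** Used in place of limits: an identity for a limit vector follows once its defect is bounded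
    through every approximation. *)
Lemma sqr_rate_eq0 (R : realType) (x c : R) :
  (forall i : nat, x ^+ 2 <= c * 16^-1 ^+ i) -> x = 0.
Proof.
move=> xc; apply/eqP; rewrite -sqrf_eq0; apply/negPn/negP => x0.
have x20 : 0 < x ^+ 2 by rewrite lt_def x0 sqr_ge0.
have c0 : 0 <= c by have := xc 0%N; rewrite expr0 mulr1; apply: le_trans; exact: sqr_ge0.
pose i := Num.bound (c / x ^+ 2).
have : c / x ^+ 2 < i%:R by apply: archi_boundP; rewrite divr_ge0 // ltW.
rewrite ltr_pdivrMr // => ci.
have := xc i; rewrite exprVn ler_pdivlMr ?exprn_gt0 //; apply/negP; rewrite -ltNge.
apply: (lt_le_trans ci); rewrite mulrC ler_wpM2l ?sqr_ge0 // -natrX ler_nat.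
by rewrite ltnW // ltn_expl.
Qed.

(** * Spectral theorem for the Gram operator *)

Section spectral.
Context (R : realType) (V W : lmodType R).
Context (ipV : V -> V -> R) (ipW : W -> W -> R) (T : V -> W) (Ts : W -> V) (C : R).
Hypotheses (ipVH : semi_inner ipV) (ipWH : semi_inner ipW).
Hypothesis adj : forall f g, ipW (T f) g = ipV f (Ts g).

Let A := gram T Ts.

(* Functions are not identified modulo null sets, so operators are linear, and
   eigenvalue equations hold, only up to vectors of seminorm zero. *)
Definition weak_eq (f g : V) := forall h, ipV f h = ipV g h.

Lemma gram_null f : ipV f f = 0 -> ipW (T f) (T f) = 0.
Proof. by move=> f0; rewrite adj (ip_null ipVH). Qed.

Section family.
Context (P : pred nat) (phi : nat -> V) (lambda : nat -> R).
Hypothesis phiON : forall k l, P k -> P l -> ipV (phi k) (phi l) = (k == l)%:R.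
Hypothesis phiA : forall l, P l -> weak_eq (A (phi l)) (lambda l *: phi l).

Let r n := [seq l <- iota 0 n | P l].

Lemma orthonormal_filter n : orthonormal_on ipV (r n) phi.
Proof. by move=> k l; rewrite !mem_filter => /andP[Pk _] /andP[Pl _]; exact: phiON. Qed.

Lemma uniq_filter_iota n : uniq (r n).
Proof. by rewrite filter_uniq // iota_uniq. Qed.

(** Yields both the sign of the eigenvalues and the orthogonality of the left singular functions. *)
Lemma gram_form_eigen k l : P k -> P l ->
  ipW (T (phi k)) (T (phi l)) = lambda k * (k == l)%:R.
Proof. by move=> Pk Pl; rewrite -(gramE ipVH ipWH adj) phiA // (ipZl ipVH) phiON. Qed.

Lemma eigenvalue_ge0 l : P l -> 0 <= lambda l.
Proof.
move=> Pl; have := gram_form_eigen Pl Pl; rewrite eqxx mulr1 => <-.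
exact: ip_ge0.
Qed.

Definition eigen_remainder n f :=
  A f - \sum_(0 <= l < n | P l) (lambda l * ipV (phi l) f) *: phi l.

(** The subtracted sum is [A] of the projection of [f], since [A] multiplies each [phi l] by
    [lambda l]; symmetry of [A] moves it onto the test vector and back. *)
Lemma eigen_remainderE n f :
  weak_eq (eigen_remainder n f) (A (f - proj ipV (r n) phi f)).
Proof.
move=> h; rewrite /eigen_remainder (ipBl ipVH) [RHS](gram_sym ipVH ipWH adj).
rewrite (ipBl ipVH) -(gram_sym ipVH ipWH adj); congr (_ - _).
rewrite (ip_suml ipVH) (ip_suml ipVH) big_filter /index_iota subn0.
apply: eq_bigr => l Pl; rewrite (ipZl ipVH) (ipZl ipVH).
rewrite -(gram_sym ipVH ipWH adj) phiA // (ipZl ipVH); ring.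
Qed.

(** The exponent of [eps] drops from 2 to 1 because the left side is <A g, g>, at most |A g| |g|,
    and projecting does not increase the norm of [f]. *)
Lemma svd_remainder_le n (eps : R) f : 0 <= eps ->
  ipV (eigen_remainder n f) (eigen_remainder n f) <= eps ^+ 2 * ipV f f ->
  ipW (T f - \sum_(0 <= l < n | P l) ipV (phi l) f *: T (phi l))
      (T f - \sum_(0 <= l < n | P l) ipV (phi l) f *: T (phi l)) <= eps * ipV f f.
Proof.
move=> eps0 Dle; pose g := f - proj ipV (r n) phi f.
have -> : ipW (T f - \sum_(0 <= l < n | P l) ipV (phi l) f *: T (phi l))
      (T f - \sum_(0 <= l < n | P l) ipV (phi l) f *: T (phi l)) = ipW (T g) (T g).
  apply: (ip_eq ipWH) => h; rewrite (ipBl ipWH) !adj /g (ipBl ipVH); congr (_ - _).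
  rewrite (ip_suml ipWH) (ip_suml ipVH) big_filter /index_iota subn0.
  apply: eq_bigr => l _.
  by rewrite (ipZl ipWH) (ipZl ipVH) adj.
rewrite -(gramE ipVH ipWH adj) -eigen_remainderE.
rewrite -ler_sqr ?nnegrE; last 2 first.
- by rewrite eigen_remainderE (gramE ipVH ipWH adj) (ip_ge0 ipWH).
- by rewrite mulr_ge0 // (ip_ge0 ipVH).
rewrite (le_trans (ip_CS ipVH _ _)) // exprMn [ipV f f ^+ 2]expr2 mulrA.
apply: ler_pM; rewrite ?(ip_ge0 ipVH) //.
exact: (proj_compl_le ipVH (uniq_filter_iota n) (@orthonormal_filter n)).
Qed.

End family.

Hypothesis HS : forall (r : seq nat) e, uniq r -> orthonormal_on ipV r e ->
  \sum_(l <- r) ipW (T (e l)) (T (e l)) <= C.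
Hypothesis VC : rate_complete ipV.

Let C_ge0 : 0 <= C. Proof. exact: (@HS_bound_ge0 _ _ _ _ ipW T _ HS). Qed.

Definition orth_to (s : seq (V * R)) g := forall p, p \in s -> ipV p.1 g = 0.

Definition eigenlist (s : seq (V * R)) :=
  forall p, p \in s -> weak_eq (A p.1) (p.2 *: p.1).

(** Symmetry of [A] keeps the complement of known eigenvectors invariant, so that maximisation can
    be repeated inside it. *)
Lemma gram_orth s g : eigenlist s -> orth_to s g -> orth_to s (A g).
Proof.
move=> sE sg p ps; rewrite -(gram_sym ipVH ipWH adj) sE //.
by rewrite (ipZl ipVH) sg // mulr0.
Qed.

(** Cauchy-Schwarz for the form <T f, T g>, at [g] and [A g]: |A g|^4 <= |T g|^2 |T A g|^2. The
    assumed bound applies to [A g] by invariance, and |A g|^2 cancels. *)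
Lemma gram_sqnorm_le s lam : 0 <= lam -> eigenlist s ->
  (forall g, orth_to s g -> ipW (T g) (T g) <= lam * ipV g g) ->
  forall g, orth_to s g -> ipV (A g) (A g) <= lam * ipW (T g) (T g).
Proof.
move=> lam0 sE Gle g sg.
have FH := form_semi_inner ipVH ipWH adj.
have := ip_CS FH g (A g); rewrite -(gramE ipVH ipWH adj) -/A.
have := Gle _ (gram_orth sE sg); have := ip_ge0 ipVH (A g).
have := ip_ge0 ipWH (T g).
move: (ipV (A g) (A g)) (ipW (T g) (T g)) (ipW (T (A g)) (T (A g))) => x y z.
move=> y0 x0 zx xz.
have [->|xn0] := eqVneq x 0; first exact: mulr_ge0.
have : x * x <= x * (lam * y).
  by rewrite -expr2 (le_trans xz) // mulrCA mulrA mulrC ler_wpM2r // mulrC.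
by rewrite ler_pM2l // lt_def xn0.
Qed.

(** For a maximising sequence v the defect |A v - lam v|^2 is at most lam (lam - |T v|^2).
    Compactness makes A v converge along a subsequence; the limit itself is the eigenvector, up to
    normalisation. *)
Lemma top_eigenvector s : eigenlist s -> exists q : V * R,
  [/\ 0 <= q.2, ipV q.1 q.1 = (q.2 != 0)%:R, weak_eq (A q.1) (q.2 *: q.1),
      orth_to s q.1 &
      forall g, orth_to s g -> ipW (T g) (T g) <= q.2 * ipV g g].
Proof.
move=> sE; have FH := form_semi_inner ipVH ipWH adj.
pose E := [set x | exists g, [/\ orth_to s g, ipV g g <= 1 & x = ipW (T g) (T g)]].
have E0 : E 0.
  exists 0; split; first by move=> p _; rewrite (ip0r ipVH).
    by rewrite (ip0r ipVH).
  by rewrite gram_null // (ip0r ipVH).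
have EC : ubound E C.
  move=> _ [g [_ g1 ->]].
  apply: (le_trans (T_bound ipVH ipWH adj HS g)).
  by have := C_ge0; have := ip_ge0 ipVH g; nra.
have supE : has_sup E by split; [exists 0|exists C].
pose lam := sup E.
have lam0 : 0 <= lam by exact: (ub_le_sup supE.2).
have Gle g : orth_to s g -> ipW (T g) (T g) <= lam * ipV g g.
  move=> sg; have [g0|g0] := eqVneq (ipV g g) 0; first by rewrite gram_null // g0 mulr0.
  have g_gt0 : 0 < ipV g g by rewrite lt_def g0 (ip_ge0 ipVH).
  pose c := (Num.sqrt (ipV g g))^-1.
  have c2 : c ^+ 2 = (ipV g g)^-1 by rewrite exprVn sqr_sqrtr // ltW.
  rewrite -ler_pdivrMr //; apply: (ub_le_sup supE.2); exists (c *: g); split.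
  - by move=> p ps; rewrite (ipZr ipVH) sg // mulr0.
  - by rewrite (ipZl ipVH) (ipZr ipVH) mulrA -expr2 c2 mulVf.
  - by rewrite (ipZl FH) (ipZr FH) mulrA -expr2 c2 mulrC.
(* If nothing is left to maximise, the zero vector with eigenvalue 0 is returned, so the iteration
   can run forever. *)
have [lam_eq0|lam_n0] := eqVneq lam 0.
  exists (0, 0); split=> //=.
  - by rewrite eqxx (ip0l ipVH).
  - by move=> h; rewrite scale0r (gram_sym ipVH ipWH adj) !(ip0l ipVH).
  - by move=> p _; rewrite (ip0r ipVH).
  - by rewrite -lam_eq0.
have lam_gt0 : 0 < lam by rewrite lt_def lam_n0.
have rate_gt0 i : 0 < 16^-1 ^+ i :> R by rewrite exprn_gt0.
have /choice[g gP] : forall i, exists g, [/\ orth_to s g, ipV g g <= 1 &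
    lam * (lam - ipW (T g) (T g)) <= 16^-1 ^+ i].
  move=> i; have [|_ [g [sg g1 ->]] gl] := @sup_adherent _ E (16^-1 ^+ i / lam) _ supE.
    by rewrite divr_gt0.
  exists g; split=> //; rewrite mulrC -ler_pdivlMr //.
  by rewrite lerBlDr -lerBlDl ltW.
have g1 i : ipV (g i) (g i) <= 1 by case: (gP i).
have [k [ki kC]] := gram_cauchy_subseq ipVH ipWH adj HS g1.
have [h0 h0P] := VC kC.
pose v i := g (k i).
have sv i : orth_to s (v i) by case: (gP (k i)).
have v1 i : ipV (v i) (v i) <= 1 by exact: g1.
have vT i : lam * (lam - ipW (T (v i)) (T (v i))) <= 16^-1 ^+ i.
  have [_ _ /le_trans] := gP (k i); apply.
  by rewrite ler_wiXn2l // ?invr_ge0 // invf_le1 // ler1n.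
(* Expanding gives |A v|^2 - 2 lam |T v|^2 + lam^2 |v|^2, where |A v|^2 <= lam |T v|^2 and |v| <=
   1. *)
have vA i : ipV (A (v i) - lam *: v i) (A (v i) - lam *: v i) <= 16^-1 ^+ i.
  apply: le_trans (vT i).
  have := gram_sqnorm_le lam0 sE Gle (sv i).
  rewrite !(ipBl ipVH, ipBr ipVH, ipZl ipVH, ipZr ipVH) (ipC ipVH _ (A (v i))).
  rewrite -/A (gramE ipVH ipWH adj (v i) (v i)).
  have : lam * (lam * ipV (v i) (v i)) <= lam * (lam * 1).
    by rewrite !ler_wpM2l.
  rewrite -/A; move: (ipV (A _) (A _)) (ipW (T _) (T _)) (ipV (v i) (v i)) => x y z.
  by rewrite mulr1; lra.
have hA i : ipV (h0 - A (v i)) (h0 - A (v i)) <= 16^-1 ^+ i by exact: h0P.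
have hv i : ipV (h0 - lam *: v i) (h0 - lam *: v i) <= 4 * 16^-1 ^+ i.
  have := ip_le2D ipVH (h0 - A (v i)) (A (v i) - lam *: v i).
  rewrite addrA subrK; have := hA i; have := vA i; lra.
have sh : orth_to s h0.
  move=> p ps; apply: (@sqr_rate_eq0 _ _ (ipV p.1 p.1 * 4)) => i.
  have -> : ipV p.1 h0 = ipV p.1 (h0 - lam *: v i).
    by rewrite (ipBr ipVH) (ipZr ipVH) (sv i) // mulr0 subr0.
  by rewrite (le_trans (ip_CS ipVH _ _)) // -mulrA ler_wpM2l // (ip_ge0 ipVH).
have Ah : weak_eq (A h0) (lam *: h0).
  move=> f; apply/eqP; rewrite -subr_eq0; apply/eqP.
  apply: (@sqr_rate_eq0 _ _ (8 * ipV (A f) (A f) + 2 * lam ^+ 2 * ipV f f)) => i.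
  have -> : ipV (A h0) f - ipV (lam *: h0) f =
      ipV (h0 - lam *: v i) (A f) - lam * ipV (h0 - A (v i)) f.
    rewrite !(ipBl ipVH, ipZl ipVH) -!(gram_sym ipVH ipWH adj) -/A; ring.
  have := ip_CS ipVH (h0 - lam *: v i) (A f).
  have := ip_CS ipVH (h0 - A (v i)) f.
  have := ler_wpM2r (ip_ge0 ipVH (A f)) (hv i).
  have := ler_wpM2r (ip_ge0 ipVH f) (hA i).
  set a := ipV (h0 - lam *: v i) (A f); set b := ipV (h0 - A (v i)) f.
  move: (_ * ipV f f) (_ * ipV (A f) (A f)) => x y xle yle bx ay.
  have : (a - lam * b) ^+ 2 <= 2 * a ^+ 2 + 2 * lam ^+ 2 * b ^+ 2.
    have := sqr_ge0 (a + lam * b); rewrite !sqrrD !sqrrN; nra.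
  move=> /le_trans; apply.
  have : lam ^+ 2 * b ^+ 2 <= lam ^+ 2 * (16^-1 ^+ i * ipV f f).
    by rewrite ler_wpM2l ?sqr_ge0 // (le_trans bx).
  move: (le_trans ay yle); lra.
have h_gt0 : 0 < ipV h0 h0.
  rewrite lt_def (ip_ge0 ipVH) andbT; apply/eqP => hh.
  move: lam_n0; apply/negP; rewrite negbK; apply/eqP.
  (* For null [h0], lam^2 |v|^2 is at most 4 units of the rate by [hv], hence so is lam |T v|^2;
     [vT] adds one more to bound lam^2. *)
  apply: (@sqr_rate_eq0 _ _ 5) => i.
  have := hv i; rewrite !(ipBl ipVH, ipBr ipVH, ipZl ipVH, ipZr ipVH) hh.
  rewrite (ipC ipVH (v i) h0) (ip_null ipVH _ hh) !mulr0 subr0 sub0r opprB subr0.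
  have := vT i; have := ler_wpM2l lam0 (Gle _ (sv i)); lra.
pose c := (Num.sqrt (ipV h0 h0))^-1.
have c2 : c ^+ 2 = (ipV h0 h0)^-1 by rewrite exprVn sqr_sqrtr // ltW.
exists (c *: h0, lam); split=> //=.
- by rewrite (ipZl ipVH) (ipZr ipVH) mulrA -expr2 c2 mulVf ?gt_eqF // lam_n0.
- move=> f; rewrite (gram_sym ipVH ipWH adj) !(ipZl ipVH) -(gram_sym ipVH ipWH adj).
  by rewrite Ah (ipZl ipVH) mulrCA.
- by move=> p ps; rewrite (ipZr ipVH) sh // mulr0.
Qed.

(** Eigenpairs are indexed by all of [nat], padded by null vectors with eigenvalue 0; the predicate
    [lambda l != 0] removes the padding. *)
Lemma spectral_decomposition : exists (lambda : nat -> R) (phi : nat -> V),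
  [/\ (forall n, 0 <= lambda n),
      (forall k l, lambda k != 0 -> lambda l != 0 ->
         ipV (phi k) (phi l) = (k == l)%:R),
      (forall n, weak_eq (A (phi n)) (lambda n *: phi n)) &
      forall n f,
        ipV (eigen_remainder (fun l => lambda l != 0) phi lambda n f)
            (eigen_remainder (fun l => lambda l != 0) phi lambda n f)
        <= (C / n.+1%:R) ^+ 2 * ipV f f].
Proof.
have FH := form_semi_inner ipVH ipWH adj.
(* The choice function is total on lists and specified only on lists of eigenpairs, so that it can
   simply be iterated. *)
have /choice[F FP] : forall s, exists q : V * R, eigenlist s ->
  [/\ 0 <= q.2, ipV q.1 q.1 = (q.2 != 0)%:R, weak_eq (A q.1) (q.2 *: q.1),
      orth_to s q.1 &
      forall g, orth_to s g -> ipW (T g) (T g) <= q.2 * ipV g g].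
  move=> s; have [/top_eigenvector[q qP]|] := pselect (eigenlist s); first by exists q.
  by exists (0, 0).
pose st n := iter n (fun s => F s :: s) [::].
have stE n : eigenlist (st n).
  elim: n => [//|n IHn] p; rewrite /= inE => /predU1P[->|]; last exact: IHn.
  by have [] := FP _ IHn.
pose q n := F (st n).
have qst k n : (k < n)%N -> q k \in st n.
  elim: n => // n IHn; rewrite ltnS leq_eqVlt => /predU1P[->|/IHn kn] /=.
    by rewrite inE eqxx.
  by rewrite inE kn orbT.
have stq n p : p \in st n -> exists2 k, (k < n)%N & p = q k.
  elim: n => // n IHn; rewrite /= inE => /predU1P[->|/IHn[k kn ->]]; first by exists n.
  by exists k => //; rewrite ltnW.
pose lam n := (q n).2; pose phi n := (q n).1.
have lam0 n : 0 <= lam n by have [] := FP _ (stE n).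
have phi1 n : ipV (phi n) (phi n) = (lam n != 0)%:R by have [] := FP _ (stE n).
have phiA n : weak_eq (A (phi n)) (lam n *: phi n) by have [] := FP _ (stE n).
have phi0 k n : (k < n)%N -> ipV (phi k) (phi n) = 0.
  by move=> kn; have [_ _ _ sq _] := FP _ (stE n); exact: (sq _ (qst _ _ kn)).
have top n g : orth_to (st n) g -> ipW (T g) (T g) <= lam n * ipV g g.
  by have [_ _ _ _] := FP _ (stE n); exact.
have phiON k l : lam k != 0 -> lam l != 0 -> ipV (phi k) (phi l) = (k == l)%:R.
  move=> k0 l0; have [kl|lk|->] := ltngtP k l; first exact: phi0.
    by rewrite (ipC ipVH) phi0.
  by rewrite phi1 l0.
(* [phi n] is orthogonal to the first [l] vectors and so competes in the maximisation at stage
   [l]. *)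
have lam_noninc l n : (l <= n)%N -> lam n <= lam l.
  move=> ln; have [->//|ln0] := eqVneq (lam n) 0.
  have : orth_to (st l) (phi n).
    by move=> p /stq[k kl ->]; rewrite phi0 // (leq_trans kl).
  move=> /top; rewrite -(gramE ipVH ipWH adj) phiA (ipZl ipVH) phi1 ln0 !mulr1.
  by [].
(* Each |T phi_l|^2 equals [lam l]; the first [n.+1] of these are at least [lam n] and sum to at
   most [C]. *)
have lam_le n : lam n <= C / n.+1%:R.
  have [->|ln0] := eqVneq (lam n) 0.
    by rewrite divr_ge0 // C_ge0.
  have lk0 k : k \in iota 0 n.+1 -> lam k != 0.
    rewrite mem_iota add0n ltnS => /andP[_ kn]; rewrite gt_eqF //.
    by rewrite (lt_le_trans _ (lam_noninc _ _ kn)) // lt_def ln0 lam0.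
  rewrite ler_pdivlMr // mulr_natr.
  have : orthonormal_on ipV (iota 0 n.+1) phi.
    by move=> k l /lk0 k0 /lk0 l0; exact: phiON.
  move=> /(HS (iota_uniq 0 n.+1)); apply: le_trans.
  have -> : lam n *+ n.+1 = \sum_(l <- iota 0 n.+1) lam n.
    by rewrite big_const_seq count_predT size_iota iter_addr_0.
  rewrite big_seq [leRHS]big_seq; apply: ler_sum => l.
  move=> lr; rewrite -(gramE ipVH ipWH adj) phiA (ipZl ipVH) phi1 lk0 // mulr1.
  by move: lr; rewrite mem_iota add0n ltnS => /andP[_]; exact: lam_noninc.
exists lam, phi; split=> // n f.
pose r := [seq l <- iota 0 n | lam l != 0].
pose g := f - proj ipV r phi f.
have rON : orthonormal_on ipV r phi.
  by move=> k l; rewrite !mem_filter => /andP[k0 _] /andP[l0 _]; exact: phiON.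
have ru : uniq r by rewrite filter_uniq // iota_uniq.
have -> : ipV (eigen_remainder (fun l => lam l != 0) phi lam n f)
            (eigen_remainder (fun l => lam l != 0) phi lam n f) = ipV (A g) (A g).
  by apply: (ip_eq ipVH); apply: eigen_remainderE => l _; exact: phiA.
(* The projection skips the padding, but padded vectors are null and hence orthogonal to
   everything. *)
have sg : orth_to (st n) g.
  move=> p /stq[k kn ->]; have [k0|k0] := eqVneq (lam k) 0.
    by rewrite (ip_null ipVH) // phi1 k0 eqxx.
  by apply: (proj_orth ipVH ru rON); rewrite mem_filter k0 mem_iota.
rewrite (le_trans (gram_sqnorm_le (lam0 n) (stE n) (top n) sg)) //.
rewrite (le_trans (ler_wpM2l (lam0 n) (top _ _ sg))) // mulrA -expr2.
apply: ler_pM; rewrite ?sqr_ge0 ?(ip_ge0 ipVH) //.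
  by rewrite ler_sqr ?nnegrE ?lam_le // divr_ge0 // C_ge0.
exact: (proj_compl_le ipVH ru rON).
Qed.

End spectral.

(** * The space L^2 *)

Notation L2fun m := (LfunType m (lee1n 2)).

Section L2_theory.
Context d (T : measurableType d) (R : realType) (m : {measure set T -> \bar R}).
Implicit Types f g h : L2fun m.

Definition L2ip (f g : T -> R) : R := \int[m]_x (f x * g x).

Lemma L2_measurable f : measurable_fun setT f.
Proof. exact: measurable_funPT. Qed.

Lemma L2_integrableM f g : m.-integrable setT (fun x => (f x * g x)%:E).
Proof. apply/Lfun1_integrable; exact: (Lfun2_mul_Lfun1 (LfunP f) (LfunP g)). Qed.

Lemma L2ipE f g : (L2ip f g)%:E = (\int[m]_x (f x * g x)%:E)%E.
Proof. by rewrite /L2ip /Rintegral fineK // integrable_fin_num //; exact: L2_integrableM. Qed.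

Lemma L2sqnormE f : (\int[m]_x (f x ^+ 2)%:E)%E = (L2ip f f)%:E.
Proof. by rewrite L2ipE; apply: eq_integral => x _; rewrite expr2. Qed.

Lemma L2ip_semi_inner : semi_inner (fun f g : L2fun m => L2ip f g).
Proof.
split=> [f g|a f g h|f].
- by apply: eq_Rintegral => x _; rewrite mulrC.
- rewrite /L2ip -RintegralZl //; last exact: L2_integrableM.
  rewrite -RintegralD //; last 2 first.
  + exact: (integrableZl measurableT a (L2_integrableM f h)).
  + exact: L2_integrableM.
  by apply: eq_Rintegral => x _ /=; rewrite mulrDl mulrA.
- by apply: Rintegral_ge0 => x _; rewrite -expr2 sqr_ge0.
Qed.

Lemma L2_mk (f : T -> R) : measurable_fun setT f ->
  (\int[m]_x (f x ^+ 2)%:E < +oo)%E -> exists g : L2fun m, g = f :> (T -> R).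
Proof.
move=> mf f2; have fL : f \in Lfun m 2%:E.
  rewrite inE; apply/andP; split; rewrite inE //=.
  rewrite /finite_norm unlock /Lnorm poweR_lty //.
  apply: le_lt_trans f2; rewrite le_eqVlt; apply/orP; left; apply/eqP.
  apply: eq_integral => x _ /=.
  by rewrite powR_mulrn // real_normK // num_real.
by exists (Lfun_Sub (lee1n 2) fL).
Qed.

Lemma L2ip_ae_eq f g h : ae_eq m setT f g -> L2ip f h = L2ip g h.
Proof.
move=> fg; rewrite /L2ip /Rintegral; congr fine; apply: ae_eq_integral => //.
- exact: measurable_int (L2_integrableM f h).
- exact: measurable_int (L2_integrableM g h).
- by apply: filterS fg => x + _ => ->.
Qed.

Lemma L2_null f : L2ip f f = 0 -> ae_eq m setT f (cst 0).
Proof.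
move=> f0; have : (\int[m]_x `|(f x ^+ 2)%:E| = 0)%E.
  transitivity (\int[m]_x (f x ^+ 2)%:E)%E; last by rewrite L2sqnormE f0.
  by apply: eq_integral => x _; rewrite gee0_abs // lee_fin sqr_ge0.
move/ae_eq_integral_abs => H; apply: filterS (H measurableT _).
  by move=> x /(_ I) /= [] /eqP; rewrite sqrf_eq0 => /eqP.
by apply/measurable_EFinP; apply: measurable_funX; exact: L2_measurable.
Qed.

Lemma L2_weak_eq_ae f g :
  (forall h : L2fun m, L2ip f h = L2ip g h) -> ae_eq m setT f g.
Proof.
move=> fg; have : L2ip (f - g) (f - g) = 0.
  have H := L2ip_semi_inner.
  by rewrite (ipBl H) fg subrr.
by move/L2_null; apply: filterS => x + _ => /(_ I) /eqP; rewrite /= subr_eq0 => /eqP.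
Qed.

(* The weights 4^k turn the summability of the squared increments into a
   geometric bound on the increments at almost every point. *)
Lemma L2_rate_complete : rate_complete (fun f g : L2fun m => L2ip f g).
Proof.
move=> h hC.
pose g k x := (4 ^+ k * (h k.+1 x - h k x) ^+ 2)%:E.
have mh k : measurable_fun setT (h k) by exact: L2_measurable.
have mg k : measurable_fun setT (g k).
  apply/measurable_EFinP; apply: measurable_funM => //.
  by apply: measurable_funX; exact: measurable_funB.
have g0 k x : (0 <= g k x)%E by rewrite lee_fin mulr_ge0 ?sqr_ge0 ?exprn_ge0.
(* The rate 16^-k for squared norms leaves the summable 4^-k after the weight 4^k. *)
have ig k : (\int[m]_x g k x <= (4^-1 ^+ k)%:E)%E.
  rewrite [leLHS](_ : _ = ((4 ^+ k)%:E * \int[m]_x ((h k.+1 - h k) x ^+ 2)%:E)%E).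
    rewrite L2sqnormE -EFinM lee_fin.
    have := hC k k.+1 (leqnSn k) => /(ler_wpM2l (exprn_ge0 k (ler0n R 4))) /le_trans.
    apply; rewrite -exprMn (_ : 4 * 16^-1 = 4^-1 :> R) //.
    by field.
  rewrite -ge0_integralZl //.
  - by apply/measurable_EFinP; apply: measurable_funX; exact: measurable_funB.
  - by move=> x _; rewrite lee_fin sqr_ge0.
pose G x := (\sum_(0 <= k <oo) g k x)%E.
have mG : measurable_fun setT G.
  by apply: ge0_emeasurable_sum => // k x _ _; exact: g0.
have G0 x : (0 <= G x)%E by apply: nneseries_ge0 => k _ _; exact: g0.
have iG : (\int[m]_x G x < +oo)%E.
  rewrite integral_nneseries //.
  apply: (@le_lt_trans _ _ (\sum_(0 <= k <oo) (4^-1 ^+ k)%:E)%E).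
    by apply: lee_nneseries => k _; [by move=> _; apply: integral_ge0 => x _; exact: g0|exact: ig].
  have /(@is_cvg_geometric_series R 1)/cvg_ex[l lP] : `|4^-1 : R| < 1.
    by rewrite ger0_norm // invf_lt1 // ltr1n.
  rewrite (_ : \sum_(0 <= k <oo) _ = l%:E)%E ?ltry //.
  apply/cvg_lim => //; rewrite (_ : (fun n => _) = EFin \o series (geometric 1 4^-1)).
    by apply/fine_cvgP; split; [exact: nearW|exact: lP].
  apply/funext => n; rewrite /= /series /= sumEFin; congr EFin.
  by apply: eq_bigr => k _; rewrite /geometric /= mul1r.
pose E := [set x | (G x < +oo)%E].
have mE : measurable E.
  by rewrite /E -[X in measurable X]setTI; exact: emeasurable_fun_infty_o.
have aeE : {ae m, forall x, E x}.
  have iGG : m.-integrable setT G.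
    apply/integrableP; split => //.
    by under eq_integral => x _ do rewrite gee0_abs //.
  have := integrable_ae measurableT iGG; apply: filterS => x /(_ I).
  by rewrite /E /= => /fin_numPlt/andP[].
have cvgE x : E x -> cvgn (fun k => h k x).
  move=> Ex.
  have [c c0 gc] : exists2 c : R, 0 <= c & forall k, (h k.+1 x - h k x) ^+ 2 <= c * 4^-1 ^+ k.
    exists (fine (G x)) => [|k]; first exact: fine_ge0.
    rewrite exprVn ler_pdivlMr ?exprn_gt0 // mulrC -lee_fin fineK; last first.
      by rewrite ge0_fin_numE.
    rewrite -[leLHS]/(g k x) /G.
    apply: (@le_trans _ _ (\sum_(0 <= i < k.+1) g i x)%E).
      by rewrite big_nat_recr //= leeDr // sume_ge0.
    by apply: nneseries_lim_ge => *; exact: g0.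
  have : cvgn (series (fun k => h k.+1 x - h k x)).
    apply: normed_cvg.
    apply: (@series_le_cvg _ _ (geometric (Num.sqrt c) 2^-1)) => [k|k|k|] /=.
    - exact: normr_ge0.
    - by rewrite mulr_ge0 ?sqrtr_ge0 // exprn_ge0.
    - rewrite -ler_sqr ?nnegrE ?mulr_ge0 ?sqrtr_ge0 ?exprn_ge0 //.
      rewrite real_normK ?num_real // exprMn sqr_sqrtr // -exprM mulnC exprM.
      rewrite (_ : 2^-1 ^+ 2 = 4^-1) ?gc //.
      by field.
    - by apply: is_cvg_geometric_series; rewrite ger0_norm // invf_lt1 // ltr1n.
  rewrite (_ : series _ = (fun k => h k x - h 0%N x)).
    move=> cs; rewrite (_ : (fun k => h k x) =
        (fun k => h k x - h 0%N x) \+ cst (h 0%N x)).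
      by apply: is_cvgD => //; exact: is_cvg_cst.
    by apply/funext => k /=; rewrite subrK.
  by apply/funext => k; rewrite /series /= telescope_sumr.
(* Cutting off to [E] makes the sequence converge at every point, so its limit is measurable. *)
pose h1 k x := h k x * \1_E x.
pose h0 x := limn (fun k => h1 k x).
have cvgh x : h1 k x @[k --> \oo] --> h0 x.
  rewrite /h0 /h1; have [Ex|nEx] := pselect (E x).
    rewrite indicE mem_set //=; under eq_fun do rewrite mulr1.
    exact: cvgE.
  rewrite indicE memNset //=; under eq_fun do rewrite mulr0.
  exact: is_cvg_cst.
have mh1 k : measurable_fun setT (h1 k) by apply: measurable_funM.
have mh0 : measurable_fun setT h0.
  by apply: (measurable_fun_cvg (h := h1)) => // x _; exact: cvgh.
have h0le i : (\int[m]_x ((h0 x - h i x) ^+ 2)%:E <= (16^-1 ^+ i)%:E)%E.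
  (* Fatou's lemma carries the bounds on [h n - h i] over to the limit. *)
  pose u n x := ((h1 n x - h i x) ^+ 2)%:E.
  rewrite (_ : (fun x => _) = (fun x => limn_einf (u ^~ x))); last first.
    apply/funext => x; apply/esym.
    have -> : u ^~ x = EFin \o (fun n => (h1 n x - h i x) ^+ 2) by [].
    apply: (cvg_limn_einf_sup _).1; apply: cvg_EFin; first exact: nearW.
    rewrite expr2; under eq_fun do rewrite expr2.
    by apply: cvgM; apply: cvgB => //; exact: cvg_cst.
  apply: (@le_trans _ _ (limn_einf (fun n => \int[m]_x u n x)%E)).
    apply: fatou => // [n|n x _]; last by rewrite lee_fin sqr_ge0.
    by apply/measurable_EFinP; apply: measurable_funX; exact: measurable_funB.
  rewrite limn_einf_lim; apply: lime_le; first exact: is_cvg_einfs.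
  exists i => // n /= ni; apply: (@le_trans _ _ (\int[m]_x u n x)%E).
    by apply: ereal_inf_lbound; exists n => /=.
  have := hC i n ni; rewrite -lee_fin -L2sqnormE; apply: le_trans.
  rewrite le_eqVlt; apply/orP; left; apply/eqP; apply: ge0_ae_eq_integral => //.
  - by apply/measurable_EFinP; apply: measurable_funX; exact: measurable_funB.
  - by apply/measurable_EFinP; apply: measurable_funX; exact: measurable_funB.
  - by move=> x _; rewrite lee_fin sqr_ge0.
  - by move=> x _; rewrite lee_fin sqr_ge0.
  - by apply: filterS aeE => x Ex _; rewrite /u /h1 indicE mem_set // mulr1.
(* Square integrability is known for the difference with [h 0], which is added back afterwards. *)
have [|//|g0' g0E] := @L2_mk (fun x => h0 x - h 0%N x).
- exact: measurable_funB.
- by apply: le_lt_trans (h0le 0%N) _; rewrite ltry.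
exists (g0' + h 0%N) => i; rewrite -lee_fin -L2sqnormE.
apply: le_trans (h0le i); rewrite le_eqVlt; apply/orP; left; apply/eqP.
by apply: eq_integral => x _ /=; rewrite g0E subrK.
Qed.

End L2_theory.

(** * Integral operators with square integrable kernel *)

Section kernel_operator.
Context d (T : measurableType d) (R : realType).
Context (m : {sigma_finite_measure set T -> \bar R}).

Notation V := (L2fun m).
Notation VV := (L2fun (m \x m)%E).

(* The integration is over the first variable of the kernel. *)
Definition kernel_op (K : T * T -> R) (f : T -> R) (y : T) : R :=
  \int[m]_x (K (x, y) * f x).

Lemma measurable_section1 (F : T * T -> R) y :
  measurable_fun setT F -> measurable_fun setT (fun x => F (x, y)).
Proof. by move=> mF; apply: measurableT_comp => //; exact: measurable_pair2. Qed.

(** Tonelli applies to the positive and negative parts separately, whether or not the sections are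
    integrable. *)
Lemma measurable_Rintegral1 (F : T * T -> R) : measurable_fun setT F ->
  measurable_fun setT (fun y => \int[m]_x F (x, y)).
Proof.
move=> mF; have mFE : measurable_fun setT (EFin \o F) by exact/measurable_EFinP.
rewrite /Rintegral; apply: measurableT_comp => //.
under eq_fun do rewrite integralE.
apply: emeasurable_funB.
- have -> : (fun y => \int[m]_x ((fun x => (F (x, y))%:E)^\+ x))%E =
     fubini_G m ((EFin \o F)^\+)%E.
    apply/funext => y; apply: eq_integral => x _.
    by rewrite -[RHS]/(((EFin \o F)^\+ \o (fun x => (x, y))) x)%E -funepos_comp.
  by apply: measurable_fun_fubini_tonelli_G => //; exact: measurable_funepos.
- have -> : (fun y => \int[m]_x ((fun x => (F (x, y))%:E)^\- x))%E =
     fubini_G m ((EFin \o F)^\-)%E.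
    apply/funext => y; apply: eq_integral => x _.
    by rewrite -[RHS]/(((EFin \o F)^\- \o (fun x => (x, y))) x)%E -funeneg_comp.
  by apply: measurable_fun_fubini_tonelli_G => //; exact: measurable_funeneg.
Qed.

Lemma kernel_section_L2 (K : VV) :
  {ae m, forall y, exists k : V, k = (fun x => K (x, y)) :> (T -> R)}.
Proof.
have mK : measurable_fun setT K by exact: L2_measurable.
have iK : (m \x m)%E.-integrable setT (fun z => (K z ^+ 2)%:E).
  by have := L2_integrableM K K; apply: eq_integrable => // z _; rewrite /= expr2.
apply: filterS (ae_integrable2 iK) => y iKy.
apply: L2_mk; first exact: measurable_section1.
move/integrableP : iKy => [_]; apply: le_lt_trans.
rewrite le_eqVlt; apply/orP; left; apply/eqP; apply: eq_integral => x _.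
by rewrite gee0_abs // lee_fin sqr_ge0.
Qed.

(** Cauchy-Schwarz on almost every section bounds the squared value at [y] by |K(., y)|^2 |f|^2;
    Tonelli integrates this in [y]. *)
Lemma kernel_op_L2 (K : VV) (f : V) :
  exists g : V, g = kernel_op K f :> (T -> R).
Proof.
have mK : measurable_fun setT K by exact: L2_measurable.
have mf : measurable_fun setT f by exact: L2_measurable.
have mT : measurable_fun setT (kernel_op K f).
  apply: (measurable_Rintegral1 (F := fun z => K z * f z.1)).
  by apply: measurable_funM => //; exact: measurableT_comp.
apply: L2_mk => //.
have mK2 : measurable_fun setT (fun z => (K z ^+ 2)%:E).
  by apply/measurable_EFinP; exact: measurable_funX.
have K20 z : (0 <= (K z ^+ 2)%:E)%E by rewrite lee_fin sqr_ge0.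
have mG := measurable_fun_fubini_tonelli_G (m1 := m) _ mK2 K20.
apply: (@le_lt_trans _ _ (\int[m]_y ((\int[m]_x (K (x, y) ^+ 2)%:E) * (L2ip m f f)%:E))%E).
  apply: ae_ge0_le_integral => //.
  - by move=> y _; rewrite lee_fin sqr_ge0.
  - by apply/measurable_EFinP; exact: measurable_funX.
  - move=> y _; apply: mule_ge0; first by apply: integral_ge0 => x _; exact: K20.
    by rewrite lee_fin; exact: ip_ge0 (L2ip_semi_inner m) f.
  - by apply: emeasurable_funM.
  - apply: filterS (kernel_section_L2 K) => y [k kE] _.
    have -> : (\int[m]_x (K (x, y) ^+ 2)%:E = (L2ip m k k)%:E)%E.
      by rewrite -L2sqnormE kE.
    rewrite -EFinM lee_fin.
    have -> : kernel_op K f y = L2ip m k f by rewrite kE.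
    exact: ip_CS (L2ip_semi_inner m) k f.
rewrite ge0_integralZr //; last 2 first.
- by move=> y _; apply: integral_ge0 => x _; exact: K20.
- by rewrite lee_fin; exact: ip_ge0 (L2ip_semi_inner m) f.
have := fubini_tonelli2 (m1 := m) (m2 := m) _ mK2 K20.
rewrite /fubini_G => <-.
by rewrite L2sqnormE -EFinM ltry.
Qed.

Definition kop (K : VV) (f : V) : V := sval (cid (kernel_op_L2 K f)).

Lemma kopE K f : kop K f = kernel_op K f :> (T -> R).
Proof. exact: svalP (cid (kernel_op_L2 K f)). Qed.

Lemma kernel_swap_L2 (K : VV) :
  exists K' : VV, K' = (fun z => K (z.2, z.1)) :> (T * T -> R).
Proof.
have mK : measurable_fun setT K by exact: L2_measurable.
have mK' : measurable_fun setT (fun z : T * T => K (z.2, z.1)).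
  apply: measurableT_comp => //.
  by apply/measurable_fun_pairP; split; [exact: measurable_snd|exact: measurable_fst].
have m2 (F : T * T -> R) : measurable_fun setT F ->
    measurable_fun setT (fun z => (F z ^+ 2)%:E).
  by move=> mF; apply/measurable_EFinP; exact: measurable_funX.
apply: L2_mk => //.
rewrite fubini_tonelli1; last 2 first.
- exact: m2.
- by move=> z; rewrite lee_fin sqr_ge0.
have := fubini_tonelli2 (m1 := m) (m2 := m) _ (m2 _ mK).
rewrite /fubini_G /fubini_F => <- => [|z]; last by rewrite lee_fin sqr_ge0.
by rewrite L2sqnormE ltry.
Qed.

Definition kswap (K : VV) : VV := sval (cid (kernel_swap_L2 K)).

Lemma kswapE K z : kswap K z = K (z.2, z.1).
Proof. by rewrite /kswap (svalP (cid (kernel_swap_L2 K))). Qed.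

Lemma tensor_L2 (f g : V) :
  exists h : VV, h = (fun z => f z.1 * g z.2) :> (T * T -> R).
Proof.
have mf : measurable_fun setT f by exact: L2_measurable.
have mg : measurable_fun setT g by exact: L2_measurable.
have mfg : measurable_fun setT (fun z : T * T => f z.1 * g z.2).
  by apply: measurable_funM; exact: measurableT_comp.
apply: L2_mk => //.
rewrite fubini_tonelli1; last 2 first.
- by apply/measurable_EFinP; exact: measurable_funX.
- by move=> z; rewrite lee_fin sqr_ge0.
rewrite /fubini_F /=.
have E x : (\int[m]_y ((f x * g y) ^+ 2)%:E = (f x ^+ 2)%:E * (L2ip m g g)%:E)%E.
  rewrite -L2sqnormE -ge0_integralZl //.
  - by apply: eq_integral => y _; rewrite exprMn EFinM.
  - by apply/measurable_EFinP; exact: measurable_funX.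
  - by move=> y _; rewrite lee_fin sqr_ge0.
  - by rewrite lee_fin sqr_ge0.
under eq_integral do rewrite E.
rewrite ge0_integralZr //.
- by rewrite L2sqnormE -EFinM ltry.
- by apply/measurable_EFinP; exact: measurable_funX.
- by move=> y _; rewrite lee_fin sqr_ge0.
- by rewrite lee_fin; exact: ip_ge0 (L2ip_semi_inner m) g.
Qed.

Definition tensor (f g : V) : VV := sval (cid (tensor_L2 f g)).

Lemma tensorE f g z : tensor f g z = f z.1 * g z.2.
Proof. by rewrite /tensor (svalP (cid (tensor_L2 f g))). Qed.

Notation ip := (L2ip m).
Notation ip2 := (L2ip (m \x m)%E).

(** Fubini. This bridge reduces adjointness, the Hilbert-Schmidt bound and orthogonality to products
    to pairings in one variable. *)
Lemma ip_kernel_tensor (K : VV) (f g : V) : ip2 K (tensor f g) = ip (kop K f) g.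
Proof.
apply: EFin_inj; rewrite !L2ipE -integral21_prod_meas1; last exact: L2_integrableM.
have iT := L2_integrableM K (tensor f g).
apply: ae_eq_integral => //.
- exact: (measurable_fubini_G iT).
- exact: measurable_int (L2_integrableM (kop K f) g).
apply: filterS (kernel_section_L2 K) => y [k kE] _; rewrite /fubini_G /= kopE.
transitivity (\int[m]_x ((g y)%:E * (k x * f x)%:E))%E.
  by apply: eq_integral => x _; rewrite tensorE kE /= -EFinM; congr EFin; ring.
rewrite integralZl //; last exact: L2_integrableM.
by rewrite -L2ipE -EFinM mulrC kE.
Qed.

Lemma ip_kernel_tensor_swap (K : VV) (f g : V) :
  ip2 K (tensor f g) = ip2 (kswap K) (tensor g f).
Proof.
apply: EFin_inj; rewrite !L2ipE -integral21_prod_meas1; last exact: L2_integrableM.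
rewrite -integral12_prod_meas1; last exact: L2_integrableM.
rewrite /fubini_F /fubini_G; apply: eq_integral => y _; apply: eq_integral => x _ /=.
by rewrite kswapE !tensorE /= [f x * _]mulrC.
Qed.

Lemma kop_adjoint (K : VV) (f g : V) : ip (kop K f) g = ip f (kop (kswap K) g).
Proof.
rewrite -ip_kernel_tensor ip_kernel_tensor_swap ip_kernel_tensor.
exact: ipC (L2ip_semi_inner m) _ _.
Qed.

Lemma kop_tensor (f g h : V) : kop (tensor f g) h = ip f h *: g :> (T -> R).
Proof.
rewrite kopE; apply/funext => y; rewrite /kernel_op /=.
rewrite -[RHS]/(ip f h * g y) /L2ip -RintegralZr //; last exact: L2_integrableM.
by apply: eq_Rintegral => x _; rewrite tensorE /=; ring.
Qed.

Lemma ip_tensor (f g f' g' : V) :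
  ip2 (tensor f g) (tensor f' g') = ip f f' * ip g g'.
Proof.
rewrite ip_kernel_tensor.
transitivity (ip (ip f f' *: g) g'); first by rewrite /L2ip kop_tensor.
exact: ipZl (L2ip_semi_inner m) _ _ _.
Qed.

Section expansion.
Context (K : VV) (r : seq nat) (e : nat -> V).
Hypotheses (ru : uniq r) (eON : orthonormal_on (fun f g : V => ip f g) r e).

Definition kernel_remainder := K - \sum_(l <- r) tensor (e l) (kop K (e l)).

Lemma kernel_remainder_orth k : k \in r ->
  ip2 kernel_remainder (tensor (e k) (kop K (e k))) = 0.
Proof.
move=> kr; have H := L2ip_semi_inner (m \x m)%E; have Hm := L2ip_semi_inner m.
rewrite /kernel_remainder (ipBl H) (ip_suml H).
under eq_bigr do rewrite ip_tensor mulrC.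
rewrite (sum_kronecker ru eON) ?ip_kernel_tensor ?subrr //.
Qed.

Lemma kernel_remainder_sqnorm : ip2 kernel_remainder kernel_remainder =
  ip2 K K - \sum_(l <- r) ip (kop K (e l)) (kop K (e l)).
Proof.
have H := L2ip_semi_inner (m \x m)%E.
rewrite {2}/kernel_remainder (ipBr H) (ip_sumr H) [X in _ - X]big_seq big1 ?subr0.
  rewrite (ipC H) /kernel_remainder (ipBr H) (ip_sumr H); congr (_ - _).
  by apply: eq_bigr => l _; rewrite ip_kernel_tensor.
by move=> l lr; exact: kernel_remainder_orth.
Qed.

(** Bessel's inequality for kernels: the remainder is orthogonal to every product subtracted, so its
    squared norm is the difference of the two sides. *)
Lemma kop_hilbert_schmidt :
  \sum_(l <- r) ip (kop K (e l)) (kop K (e l)) <= ip2 K K.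
Proof.
by rewrite -subr_ge0 -kernel_remainder_sqnorm; exact: ip_ge0 (L2ip_semi_inner _) _.
Qed.

End expansion.
End kernel_operator.

(** * Convergence of the kernel expansion *)

Section kernel_expansion.
Context d (T : measurableType d) (R : realType).
Context (m : {sigma_finite_measure set T -> \bar R}).

Notation V := (L2fun m).
Notation VV := (L2fun (m \x m)%E).
Notation ip := (L2ip m).
Notation ip2 := (L2ip (m \x m)%E).

Lemma L2_indic (A : set T) : measurable A -> (m A < +oo)%E ->
  exists f : V, f = \1_A :> (T -> R).
Proof.
move=> mA Aoo; apply: L2_mk; first exact: measurable_indic.
rewrite (_ : (\int[m]_x _ = m A)%E) //.
have <- : (\int[m]_x (\1_A x)%:E = m A)%E by rewrite integral_indic // setIT.
apply: eq_integral => x _; rewrite indicE; case: (x \in A).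
  by rewrite expr1n.
by rewrite expr0n.
Qed.

Lemma L2_rectangle (r : VV) (A B : set T) : measurable A -> measurable B ->
  (m A < +oo)%E -> (m B < +oo)%E -> exists f g : V,
    (EFin \o r) \_ (A `*` B) = (fun z => (r z * tensor f g z)%:E).
Proof.
move=> mA mB Aoo Boo.
have [f fE] := L2_indic mA Aoo; have [g gE] := L2_indic mB Boo.
exists f, g; apply/funext => z; rewrite tensorE fE gE !indicE /patch in_setX.
by case: (_ \in A); case: (_ \in B); rewrite /= ?mulr1 ?mulr0.
Qed.

(** Products of indicators show that [r] integrates to zero over rectangles with sides of finite
    measure. Inside one of these, where [r] is integrable, Dynkin's theorem extends this to all
    measurable subsets; countably many such rectangles cover the plane. *)
Lemma L2_orth_tensors_ae0 (r : VV) :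
  (forall f g : V, ip2 r (tensor f g) = 0) -> ae_eq (m \x m)%E setT r (cst 0).
Proof.
move=> r0.
have rect A B : measurable A -> measurable B -> (m A < +oo)%E -> (m B < +oo)%E ->
    (\int[(m \x m)%E]_(z in A `*` B) (r z)%:E = 0)%E.
  move=> mA mB Aoo Boo; rewrite integral_mkcond.
  have [f [g E]] := L2_rectangle r mA mB Aoo Boo.
  rewrite [X in (\int[_]_z X z)%E](_ : _ = (fun z => (r z * tensor f g z)%:E)) //.
  by rewrite -L2ipE r0.
have [F FT Fm] := sigma_finiteT m.
have Q0 A B : measurable A -> measurable B -> (m A < +oo)%E -> (m B < +oo)%E ->
    ae_eq (m \x m)%E (A `*` B) (EFin \o r) (cst 0%E).
  move=> mA mB Aoo Boo.
  have mQ : measurable (A `*` B) by exact: measurableX.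
  have iQ : (m \x m)%E.-integrable (A `*` B) (EFin \o r).
    apply/(integrable_mkcond _ mQ); have [f [g ->]] := L2_rectangle r mA mB Aoo Boo.
    exact: L2_integrableM.
  have iS S : measurable S -> (m \x m)%E.-integrable (S `&` (A `*` B)) (EFin \o r).
    by move=> mS; apply: integrableS iQ => //; exact: measurableI.
  have all0 S : measurable S -> (\int[(m \x m)%E]_(z in S `&` (A `*` B)) (r z)%:E = 0)%E.
    move=> mS.
    apply: (@dynkin_induction _ _
      [set A1 `*` A2 | A1 in measurable & A2 in measurable]
      (fun S => (\int[(m \x m)%E]_(z in S `&` (A `*` B)) (r z)%:E = 0)%E)).
    - exact: measurable_prod_measurableType.
    - move=> X Y [X1 mX1 [X2 mX2 <-{X}]] [Y1 mY1 [Y2 mY2 <-{Y}]].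
      exists (X1 `&` Y1); first exact: measurableI.
      by exists (X2 `&` Y2); [exact: measurableI|rewrite setXI].
    - by rewrite setTI; exact: rect.
    - move=> _ [X1 mX1 [X2 mX2 <-]]; rewrite -setXI; apply: rect.
      + exact: measurableI.
      + exact: measurableI.
      + by rewrite (le_lt_trans _ Aoo) // measureIr.
      + by rewrite (le_lt_trans _ Boo) // measureIr.
    - move=> X mX X0.
      have := rect _ _ mA mB Aoo Boo.
      rewrite -[X in (\int[_]_(z in X) _)%E](setTI (A `*` B)) -(setUv X) setIUl.
      rewrite integral_setU; last 4 first.
      + exact: measurableI.
      + by apply: measurableI => //; exact: measurableC.
      + rewrite -setIUl setUv; exact: measurable_int (iS _ measurableT).
      + by apply/disj_setPS => z [[Xz _] [nXz _]]; exact: nXz.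
      by rewrite X0 add0e.
    - move=> G mG tG G0; rewrite setI_bigcupl integral_bigcup //.
      + by rewrite eseries0.
      + by apply: trivIset_setIr.
      + by move=> k; exact: measurableI.
      + rewrite -setI_bigcupl; apply: iS; exact: bigcup_measurable.
    - by rewrite -measurable_prod_measurableType.
  apply: integral_ae_eq => // E EQ mE.
  by rewrite [RHS]integral0 -(all0 _ mE) (setIidl EQ).
have : {ae (m \x m)%E, forall z, forall i j, (F i `*` F j) z -> r z = 0}.
  apply: ae_foralln => i; apply: ae_foralln => j.
  have [mi ioo] := Fm i; have [mj joo] := Fm j.
  by have := Q0 _ _ mi mj ioo joo; apply: filterS => z zQ /zQ [].
apply: filterS => z zF _ /=.
have [i _ iz] : (\bigcup_i F i) z.1 by rewrite -FT.
have [j _ jz] : (\bigcup_i F i) z.2 by rewrite -FT.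
exact: (zF i j).
Qed.

Lemma rate_small (delta : R) : 0 < delta ->
  exists i0, forall i, (i0 <= i)%N -> 16^-1 ^+ i <= delta.
Proof.
move=> d0; exists (Num.bound delta^-1) => i ji.
rewrite exprVn invf_ple ?posrE ?exprn_gt0 //.
apply: (@le_trans _ _ i%:R).
  rewrite (le_trans (ltW (archi_boundP _))) ?ler_nat ?invr_ge0 ?ltW //.
by rewrite -natrX ler_nat ltnW // ltn_expl.
Qed.

Section limit.
Context (K : VV) (P : pred nat) (phi : nat -> V).
Hypothesis phiON : forall k l, P k -> P l -> ip (phi k) (phi l) = (k == l)%:R.
Hypothesis Tlim : forall f : V, forall eps : R, 0 < eps ->
  exists N, forall n, (N <= n)%N ->
  let g : V := kop K f - \sum_(0 <= l < n | P l) ip (phi l) f *: kop K (phi l) in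
  ip g g <= eps.

Let idx n := [seq l <- iota 0 n | P l].
Let rem n := kernel_remainder K (idx n) phi.

Let H : semi_inner (fun f g : VV => ip2 f g) := L2ip_semi_inner _.
Let Hm : semi_inner (fun f g : V => ip f g) := L2ip_semi_inner _.

Let idx_uniq n : uniq (idx n). Proof. by rewrite filter_uniq // iota_uniq. Qed.

Let idx_ON n : orthonormal_on (fun f g : V => ip f g) (idx n) phi.
Proof. by move=> k l; rewrite !mem_filter => /andP[Pk _] /andP[Pl _]; exact: phiON. Qed.

(** [rem i - rem j] consists of terms with i <= l < j, each orthogonal to [rem j]; Pythagoras then
    makes the norms nonincreasing. *)
Let ip_rem i j : (i <= j)%N -> ip2 (rem i) (rem j) = ip2 (rem j) (rem j).
Proof.
move=> ij; apply/eqP; rewrite -subr_eq0 -(ipBl H); apply/eqP.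
have -> : rem i - rem j = \sum_(l <- [seq l <- iota i (j - i) | P l])
    tensor (phi l) (kop K (phi l)).
  rewrite /rem /kernel_remainder opprB addrC subrKA.
  by rewrite -{1}(subnKC ij) /idx iotaD filter_cat big_cat /= add0n addrAC subrr add0r.
rewrite (ip_suml H) big_seq big1 // => l; rewrite mem_filter mem_iota => /andP[Pl].
rewrite subnKC // => /andP[_ lj]; rewrite (ipC H).
by apply: (kernel_remainder_orth K (idx_uniq j) (@idx_ON j)); rewrite mem_filter Pl mem_iota.
Qed.

Let rem_noninc i j : (i <= j)%N -> ip2 (rem j) (rem j) <= ip2 (rem i) (rem i).
Proof.
move=> ij; rewrite -subr_ge0 -(ip_pythagoras H (ip_rem ij)).
exact: ip_ge0 H _.
Qed.

Lemma kernel_expansion (eps : R) : 0 < eps ->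
  exists N, forall n, (N <= n)%N -> ip2 (rem n) (rem n) <= eps.
Proof.
move=> eps0.
pose a n := ip2 (rem n) (rem n).
have a0 n : 0 <= a n by exact: ip_ge0 H _.
have ha : has_inf (range a) by split; [exists (a 0%N), 0%N|exists 0 => _ [n _ <-]].
have /choice[N HN] : forall i, exists N, a N <= inf (range a) + 16^-1 ^+ i.
  move=> i; have [|_ [n _ <-] an] := @inf_adherent _ _ (16^-1 ^+ i) _ ha.
    by rewrite exprn_gt0.
  by exists n; exact: ltW.
(* Summing the [N l] makes [k] monotone and at least both [i] and [N i]. *)
pose k i := (i + \sum_(l < i.+1) N l)%N.
have Nk i : (N i <= k i)%N by rewrite /k big_ord_recr /= addnA leq_addl.
have k_mono i j : (i <= j)%N -> (k i <= k j)%N.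
  move=> ij; rewrite /k leq_add // -!(big_mkord xpredT N).
  by rewrite [leqRHS](big_cat_nat _ _ (n := i.+1)) //= leq_addr.
have remC i j : (i <= j)%N ->
    ip2 (rem (k j) - rem (k i)) (rem (k j) - rem (k i)) <= 16^-1 ^+ i.
  move=> ij; rewrite (ip_pythagoras H (ip_rem (k_mono _ _ ij))).
  have /le_trans/(_ (HN i)) := rem_noninc (Nk i).
  have : inf (range a) <= a (k j) by apply: ge_inf; [exact: ha.2|exists (k j)].
  rewrite /a; lra.
have [r rP] := L2_rate_complete remC.
have r0 : ae_eq (m \x m)%E setT r (cst 0).
  apply: L2_orth_tensors_ae0 => f g; apply/eqP; rewrite -sqrf_eq0.
  rewrite eq_le sqr_ge0 andbT; apply/ler_addgt0Pl => e e0; rewrite addr0.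
  (* With both errors at most [e / (4 * c)], the two Cauchy-Schwarz bounds add up to at most
     [e / 4], and the square of a sum costs a factor 2. *)
  set t := tensor f g; pose c := 1 + ip2 t t + ip g g.
  have c0 : 0 < c.
    by rewrite ltr_pwDl ?(ip_ge0 Hm) // ltr_pwDl // (ip_ge0 H).
  have e4 : 0 < e / (4 * c) by rewrite divr_gt0 // mulr_gt0.
  have [n1 Hn1] := Tlim f e4.
  have [n2 Hn2] := rate_small e4.
  pose i := maxn n1 n2.
  pose g' : V := kop K f - \sum_(0 <= l < k i | P l) ip (phi l) f *: kop K (phi l).
  have g'_small : ip g' g' <= e / (4 * c).
    exact: Hn1 (k i) (leq_trans (leq_maxl _ _) (leq_addr _ _)).
  have i_small := Hn2 i (leq_maxr _ _).
  have remt : ip2 (rem (k i)) t = ip g' g.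
    rewrite /rem /kernel_remainder (ipBl H) ip_kernel_tensor (ip_suml H).
    rewrite /g' (ipBl Hm) (ip_suml Hm) big_filter /index_iota subn0.
    congr (_ - _); apply: eq_bigr => l _.
    by rewrite ip_tensor (ipZl Hm).
  have := ip_CS Hm g' g; rewrite -remt.
  have := ip_CS H (r - rem (k i)) t; have := ler_wpM2r (ip_ge0 H t) (rP i).
  have := ler_wpM2r (ip_ge0 Hm g) g'_small; have := ler_wpM2r (ip_ge0 H t) i_small.
  have -> : ip2 r t = ip2 (r - rem (k i)) t + ip2 (rem (k i)) t.
    by rewrite (ipBl H) subrK.
  have tt0 := ip_ge0 H t; have gg0 := ip_ge0 Hm g.
  have tc : e / (4 * c) * ip2 t t + e / (4 * c) * ip g g <= e / 4.
    rewrite -mulrDr.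
    have -> : e / 4 = e / (4 * c) * c by field; rewrite gt_eqF.
    by rewrite ler_wpM2l ?(ltW e4) // /c -addrA lerDr.
  move: (ip2 (r - _) t) (ip2 (rem _) t) tc => x y.
  move: (_ * ip2 t t) (_ * ip g g) => z1 z2 z12 h1 h2 h3 h4 h5.
  have := sqr_ge0 (x - y); rewrite sqrrB sqrrD; nra.
have rr0 : ip2 r r = 0.
  by rewrite (L2ip_ae_eq (g := 0 : VV) r r0) (ip0l H).
have [i Hi] := rate_small eps0.
exists (k i) => n /rem_noninc /le_trans; apply.
apply: le_trans (Hi i (leqnn i)); apply: le_trans (rP i).
have rn (g : VV) : ip2 r g = 0 by exact: (ip_null H g rr0).
have E : ip2 (r - rem (k i)) (r - rem (k i)) =
    ip2 r r - 2 * ip2 r (rem (k i)) + ip2 (rem (k i)) (rem (k i)).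
  exact: (ip_sqnormB H).
by rewrite E !rn mulr0 subr0 add0r.
Qed.

End limit.
End kernel_expansion.

(** * Completed measurability and null sets *)

Lemma ae_of_null d (T : measurableType d) (R : realType)
    (m : {measure set T -> \bar R}) (N : set T) (P : T -> Prop) :
  measurable N -> m N = 0%E -> (forall x, ~ N x -> P x) -> {ae m, forall x, P x}.
Proof.
move=> mN N0 NP; suff H : almost_everywhere m P by [].
by exists N; split=> // x /= nP; apply: contrapT => /NP.
Qed.

Section nonmeasurable_integrals.
Context d (T : measurableType d) (R : realType) (m : {measure set T -> \bar R}).

Import HBNNSimple.

(* Neither side is assumed measurable: a simple function below [f] is turned
   into one below [g] by cutting off the exceptional null set. *)
Lemma ge0_ae_le_integral_any (f g : T -> \bar R) :
  (forall x, 0 <= f x)%E -> (forall x, 0 <= g x)%E -> ae_eq m setT f g ->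
  (\int[m]_x f x <= \int[m]_x g x)%E.
Proof.
move=> f0 g0 [N [mN N0 fgN]].
rewrite (ge0_integralTE m f0) (ge0_integralTE m g0) /=.
apply: ge_ereal_sup => _ [h hf <-].
have mNC : measurable (~` N) by exact: measurableC.
apply: (@le_trans _ _ (sintegral m (proj_nnsfun h mNC))); last first.
  apply: ereal_sup_ubound; exists (proj_nnsfun h mNC) => // x /=.
  rewrite mindicE; have [xN|xN] := boolP (x \in ~` N); last by rewrite mulr0.
  rewrite mulr1 (_ : g x = f x) //; apply: contrapT => gf.
  by move: xN; rewrite inE; apply; apply: fgN => /= /(_ I) fg; exact: gf.
rewrite -!integralT_nnsfun le_eqVlt; apply/orP; left; apply/eqP.
apply: ge0_ae_eq_integral => //.
- exact/measurable_EFinP.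
- exact/measurable_EFinP.
- by move=> x _; rewrite lee_fin.
- by move=> x _; rewrite lee_fin.
exists N; split=> // x /= nfx; apply: contrapT => xN; apply: nfx => _.
by rewrite mindicE mem_set // mulr1.
Qed.

(** Allows completed measurable integrands to be exchanged for their Borel versions. *)
Lemma ae_eq_integral_any (f g : T -> \bar R) :
  ae_eq m setT f g -> (\int[m]_x f x = \int[m]_x g x)%E.
Proof.
move=> fg; have [fgp fgn] := (ae_eq_funeposneg m setT f g).1 fg.
rewrite integralE [RHS]integralE; congr (_ - _)%E; apply/eqP; rewrite eq_le.
  rewrite !ge0_ae_le_integral_any //; exact: ae_eq_sym.
rewrite !ge0_ae_le_integral_any //; exact: ae_eq_sym.
Qed.

Lemma ae_eq_Rintegral_any (D : set T) (f g : T -> R) :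
  {ae m, forall x, (f \_ D) x = g x} -> \int[m]_(x in D) f x = \int[m]_x g x.
Proof.
move=> fg; rewrite Rintegral_mkcond /Rintegral; congr fine.
by apply: ae_eq_integral_any; apply: filterS fg => x /= -> .
Qed.

End nonmeasurable_integrals.

Section completed_measurable.
Context d (T : measurableType d) (R : realType) (m : {measure set T -> \bar R}).

(* The witness agrees with [f] off the union of the null sets attached to the
   preimages of the rational half-lines. *)
Lemma completed_borel_version (D : set T) (f : T -> R) : measurable D ->
  completed_measurable_fun m D f -> exists g : T -> R,
    [/\ measurable_fun setT g, {ae m, forall x, D x -> f x = g x} &
        forall x, ~ D x -> g x = 0].
Proof.
move=> mD cf.
pose q (n : nat) : R := ratr (odflt 0 (unpickle n : option rat)).
have /choice[A AP] : forall n, exists A, measurable A /\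
    exists N, m.-negligible N /\ D `&` f @^-1` `]-oo, q n[ = A `|` N.
  move=> n; have [A mA [N mN E]] := cf `]-oo, q n[%classic (measurable_itv _).
  by exists A; split=> //; exists N; split.
have /choice[N NP] : forall n, exists N, [/\ measurable N, m N = 0%E &
    (D `&` f @^-1` `]-oo, q n[) `\` N = A n `\` N].
  move=> n; have [mA [N [[N' [mN' N'0 NN']] E]]] := AP n.
  exists N'; split=> //; rewrite E setDUl [X in _ `|` X](_ : _ = set0) ?setU0 //.
  by apply/seteqP; split=> // x [/NN'].
pose M := \bigcup_n N n.
have mM : measurable M by apply: bigcupT_measurable => n; case: (NP n).
have M0 : m.-negligible M.
  by apply: negligible_bigcup => n; exists (N n); have [] := NP n; split.
pose E := D `\` M.
have mE : measurable E by exact: measurableD.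
have ME n : measurable (E `&` f @^-1` `]-oo, q n[).
  rewrite (_ : _ `&` _ = A n `\` M); first by apply: measurableD => //; exact: (AP n).1.
  have [_ _ Nn] := NP n; apply/seteqP; split=> [x [[Dx Mx] fx]|x [Ax Mx]].
    split=> //; have : (A n `\` N n) x.
      by rewrite -Nn; split=> // Nx; apply: Mx; exists n.
    by case.
  have : (A n `\` N n) x by split=> // Nx; apply: Mx; exists n.
  by rewrite -Nn => -[[Dx fx] _].
exists (f \_ E); split.
- apply/(measurable_restrictT _ mE).
  move=> _; apply: (@measurability _ _ _ _ _ _ (@RGenInftyO.G R)).
    exact: RGenInftyO.measurableE.
  move=> _ [_ [r ->] <-].
  (* By density of the rationals, an open half-line is the union of the rational ones inside it. *)
  rewrite (_ : E `&` _ = \bigcup_(n in [set n | q n <= r])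
      (E `&` f @^-1` `]-oo, q n[)).
    by apply: bigcup_measurable.
  apply/seteqP; split=> x.
    move=> [Ex]; rewrite /= in_itv /= => fr.
    have [a] := rat_in_itvoo fr; rewrite in_itv /= => /andP[fa ar].
    have qa : q (pickle a) = ratr a by rewrite /q pickleK.
    by exists (pickle a); rewrite /= qa; [exact: ltW|split=> //=; rewrite in_itv].
  move=> [n /= nr [Ex]]; rewrite /= in_itv /= => fn.
  by split=> //=; rewrite in_itv /= (lt_le_trans fn).
- exact: mE.
- have [M' [mM' M'0 MM']] := M0; apply: (ae_of_null mM' M'0) => x nM'x Dx.
  have Mx : ~ M x by move=> /MM'.
  by rewrite patchT // inE.
- by move=> x Dx; rewrite patchN // notin_setE => -[].
Qed.

Lemma completed_measurable_of_ae (D : set T) (f g : T -> R) : measurable D ->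
  measurable_fun setT g -> {ae m, forall x, D x -> f x = g x} ->
  completed_measurable_fun m D f.
Proof.
move=> mD mg [N [mN N0 fgN]] B mB.
exists ((D `&` g @^-1` B) `\` N).
  apply: measurableD => //; apply: measurableI => //.
  by rewrite -[X in measurable X]setTI; exact: mg.
exists (D `&` f @^-1` B `&` N).
  by exists N; split=> // x [].
have fg x : D x -> ~ N x -> f x = g x.
  by move=> Dx Nx; apply: contrapT => nfg; apply: Nx; apply: fgN => /= /(_ Dx).
apply/seteqP; split=> x.
  by case=> [[[Dx Bx] Nx]|[[]]] //; split=> //; rewrite /= fg.
move=> [Dx Bx]; have [Nx|Nx] := pselect (N x); [by right|left].
by split=> //; split=> //; rewrite /= -fg.
Qed.

End completed_measurable.

Section almost_everywhere_product.
Context d (T : measurableType d) (R : realType).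
Context (m : {sigma_finite_measure set T -> \bar R}).

Lemma ae_fst (P : T -> Prop) : {ae m, forall x, P x} ->
  {ae (m \x m)%E, forall z, P z.1}.
Proof.
move=> [N [mN N0 PN]]; apply: (@ae_of_null _ _ _ _ (N `*` setT)).
- exact: measurableX.
- apply: (etrans (product_measure1E _ _ mN measurableT)).
  exact: (etrans (congr1 (fun t => t * _)%E N0) (mul0e _)).
- by move=> z Nz; apply: contrapT => nP; apply: Nz; split=> //=; exact: PN.
Qed.

Lemma ae_snd (P : T -> Prop) : {ae m, forall x, P x} ->
  {ae (m \x m)%E, forall z, P z.2}.
Proof.
move=> [N [mN N0 PN]]; apply: (@ae_of_null _ _ _ _ (setT `*` N)).
- exact: measurableX.
- apply: (etrans (product_measure1E _ _ measurableT mN)).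
  exact: (etrans (congr1 (fun t => _ * t)%E N0) (mule0 _)).
- by move=> z Nz; apply: contrapT => nP; apply: Nz; split=> //=; exact: PN.
Qed.

Let null_indic (N : set (T * T)) : measurable N -> (m \x m)%E N = 0%E ->
  (\int[(m \x m)%E]_z (\1_N z)%:E = 0)%E.
Proof. by move=> mN N0; rewrite integral_indic // setIT. Qed.

Let ae0_indic (A : set T) : measurable A -> (\int[m]_x (\1_A x)%:E = 0 :> \bar R)%E ->
  m A = 0%E.
Proof. by move=> mA; rewrite integral_indic // setIT. Qed.

(** Tonelli for the indicator of the exceptional set: almost all of its sections are null. *)
Lemma ae_sections2 (P : T * T -> Prop) : {ae (m \x m)%E, forall z, P z} ->
  {ae m, forall y, {ae m, forall x, P (x, y)}}.
Proof.
move=> [N [mN N0 PN]].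
have m1N : measurable_fun setT (EFin \o (\1_N : T * T -> R)).
  by apply/measurable_EFinP; exact: measurable_indic.
have p1N z : (0 <= (EFin \o (\1_N : T * T -> R)) z)%E by rewrite /= lee_fin indicE.
have := null_indic mN N0; rewrite fubini_tonelli2 // => G0.
have : (\int[m]_y `|fubini_G m (EFin \o \1_N) y| = 0)%E.
  rewrite -G0; apply: eq_integral => y _; rewrite gee0_abs //.
  by apply: integral_ge0 => x _; exact: p1N.
have mG := measurable_fun_fubini_tonelli_G (m1 := m) _ m1N p1N.
move/(ae_eq_integral_abs m measurableT mG); apply: filterS => y /(_ I) /=.
rewrite /fubini_G => y0.
have mNy : measurable (ysection N y) by exact: measurable_ysection.
apply: (ae_of_null mNy).
  apply: ae0_indic => //; rewrite -[RHS]y0; apply: eq_integral => x _ /=.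
  by rewrite !indicE mem_ysection.
move=> x Nx; apply: contrapT => nP; apply: Nx.
by rewrite /ysection /= mem_set //; exact: PN.
Qed.

Lemma ae_sections1 (P : T * T -> Prop) : {ae (m \x m)%E, forall z, P z} ->
  {ae m, forall x, {ae m, forall y, P (x, y)}}.
Proof.
move=> [N [mN N0 PN]].
have m1N : measurable_fun setT (EFin \o (\1_N : T * T -> R)).
  by apply/measurable_EFinP; exact: measurable_indic.
have p1N z : (0 <= (EFin \o (\1_N : T * T -> R)) z)%E by rewrite /= lee_fin indicE.
have := null_indic mN N0; rewrite fubini_tonelli1 // => F0.
have : (\int[m]_x `|fubini_F m (EFin \o \1_N) x| = 0)%E.
  rewrite -F0; apply: eq_integral => x _; rewrite gee0_abs //.
  by apply: integral_ge0 => y _; exact: p1N.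
have mF := measurable_fun_fubini_tonelli_F (m2 := m) _ m1N p1N.
move/(ae_eq_integral_abs m measurableT mF); apply: filterS => x /(_ I) /=.
rewrite /fubini_F => x0.
have mNx : measurable (xsection N x) by exact: measurable_xsection.
apply: (ae_of_null mNx).
  apply: ae0_indic => //; rewrite -[RHS]x0; apply: eq_integral => y _ /=.
  by rewrite !indicE mem_xsection.
move=> y Ny; apply: contrapT => nP; apply: Ny.
by rewrite /xsection /= mem_set //; exact: PN.
Qed.

End almost_everywhere_product.

Lemma measurable_funV_ge0 d (T : measurableType d) (R : realType) (f : T -> R) :
  measurable_fun setT f -> (forall x, 0 <= f x) ->
  measurable_fun setT (fun x => (f x)^-1).
Proof.
move=> mf f0; rewrite (_ : (fun x => _) = (fun x => f x `^ (-1))).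
  exact: (measurableT_comp (measurable_powR _) mf).
by apply/funext => x; rewrite powR_inv1.
Qed.

Lemma measurable_fun_sqrt d (T : measurableType d) (R : realType) (f : T -> R) :
  measurable_fun setT f -> measurable_fun setT (fun x => Num.sqrt (f x)).
Proof.
move=> mf; exact: (measurableT_comp (continuous_measurable_fun (@sqrt_continuous R)) mf).
Qed.

(** * Weighted L^2 spaces *)

#[local] Instance ae_lebesgue_filter (R : realType) :
  Filter (nbhs (almost_everywhere (@lebesgue_measure R))).
Proof. exact: (@ae_filter_ringOfSetsType _ _ _ (@lebesgue_measure R)). Qed.

Section weighted_L2.
Context (R : realType).

Notation leb := (@lebesgue_measure R).
Notation D := (`[0%R, 1%R]%classic : set R).
Notation V := (L2fun leb).
Notation ip := (L2ip leb).

Definition borel_weight (rho : R -> R) : Prop :=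
  (exists rho' : measurableTypeR R -> R, measurable_fun setT rho' /\
     {ae leb, forall x, D x -> rho x = rho' x}) /\
  (forall x, D x -> 0 < rho x).

(* [u] in L^2_rho corresponds to [u * sqrt rho], cut off outside [0, 1], in
   the unweighted L^2(R). *)
Definition represents (rho u : R -> R) (f : V) : Prop :=
  {ae leb, forall x, ((fun x => u x * Num.sqrt (rho x)) \_ D) x = f x}.

Lemma measurable_unitI : measurable (D : set (measurableTypeR R)).
Proof. exact: measurable_itv. Qed.

Section one_weight.
Context (rho : R -> R).
Hypothesis rhoW : borel_weight rho.

Lemma sqrt_weight x : D x -> Num.sqrt (rho x) * Num.sqrt (rho x) = rho x.
Proof. by move=> Dx; rewrite -expr2 sqr_sqrtr // ltW // rhoW.2. Qed.

Lemma represents_inner u (f : V) v (g : V) : represents rho u f -> represents rho v g ->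
  inner rho u v = ip f g.
Proof.
move=> uf vg; apply: ae_eq_Rintegral_any; apply: filterS2 uf vg => x <- <-.
rewrite !patchE; case: ifPn => [/set_mem Dx|_]; last by rewrite mulr0.
by rewrite mulrACA sqrt_weight.
Qed.

Lemma represents_sqnorm u (f : V) : represents rho u f -> sqnorm rho u = (ip f f)%:E.
Proof.
move=> uf; rewrite L2ipE /sqnorm [LHS]integral_mkcond; apply: ae_eq_integral_any.
apply: filterS uf => x uf _; rewrite -uf !patchE.
case: ifPn => [/set_mem Dx|_]; last by rewrite mulr0.
by rewrite mulrACA sqrt_weight.
Qed.

Lemma represents_L2 u (f : V) : represents rho u f -> L2 rho u.
Proof.
move=> uf; split; last by rewrite (represents_sqnorm uf) ltry.
have [[rho' [mrho' rhoE]] rho0] := rhoW.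
apply: (completed_measurable_of_ae (g := fun x => f x * (Num.sqrt (rho' x))^-1)).
- exact: measurable_unitI.
- apply: measurable_funM; first exact: L2_measurable.
  by apply: measurable_funV_ge0 => [|x]; [exact: measurable_fun_sqrt|exact: sqrtr_ge0].
- apply: filterS2 uf rhoE => x <- rhox Dx.
  rewrite -(rhox Dx) patchT ?inE // mulfK // gt_eqF // sqrtr_gt0; exact: rho0.
Qed.

Lemma L2_represents u : L2 rho u -> exists f, represents rho u f.
Proof.
move=> [cu u2]; have [[rho' [mrho' rhoE]] rho0] := rhoW.
have [u' [mu' uE u'0]] := completed_borel_version measurable_unitI cu.
pose f x := u' x * Num.sqrt (rho' x).
have mf : measurable_fun setT f by apply: measurable_funM => //; exact: measurable_fun_sqrt.
have fE : {ae leb, forall x, ((fun x => u x * Num.sqrt (rho x)) \_ D) x = f x}.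
  apply: filterS2 rhoE uE => x rhox ux.
  rewrite patchE /f; case: ifPn => [/set_mem Dx|]; last first.
    by rewrite notin_setE => Dx; rewrite u'0 // mul0r.
  by rewrite rhox ?ux.
have [|f' f'E] := @L2_mk _ _ _ leb f mf; last by exists f'; rewrite /represents f'E.
apply: le_lt_trans u2; rewrite le_eqVlt; apply/orP; left; apply/eqP.
rewrite /sqnorm [RHS]integral_mkcond; apply: ae_eq_integral_any.
apply: filterS fE => x fx _; rewrite -fx !patchE.
case: ifPn => [/set_mem Dx|_]; last by rewrite expr0n.
by rewrite expr2 mulrACA sqrt_weight.
Qed.

Lemma represents_quotient (f : V) : {ae leb, forall x, ~ D x -> f x = 0} ->
  represents rho (fun x => f x / Num.sqrt (rho x)) f.
Proof.
apply: filterS => x f0; rewrite patchE; case: ifPn => [/set_mem Dx|].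
  by rewrite divfK // gt_eqF // sqrtr_gt0; exact: rhoW.2.
by rewrite notin_setE => /f0.
Qed.

Lemma represents_ae u (f : V) v (g : V) : represents rho u f -> represents rho v g ->
  ae_eq leb D u v <-> ae_eq leb setT f g.
Proof.
move=> uf vg; split=> [uv|fg].
  apply: filterS3 uf vg uv => x <- <- uv _.
  by rewrite !patchE; case: ifPn => // /set_mem /uv ->.
apply: filterS3 uf vg fg => x <- <- fg Dx.
move: (fg I); rewrite !patchT ?inE // => /mulIf; apply.
by rewrite gt_eqF // sqrtr_gt0; exact: rhoW.2.
Qed.

Lemma represents0 : represents rho (fun=> 0) 0.
Proof. by apply: nearW => x; rewrite patchE mul0r if_same. Qed.

Lemma represents_lin a u (f : V) v (g : V) : represents rho u f -> represents rho v g ->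
  represents rho (fun x => a * u x + v x) (a *: f + g).
Proof.
move=> uf vg; apply: filterS2 uf vg => x fx gx.
rewrite -[RHS]/(a * f x + g x) -fx -gx !patchE; case: ifPn => _.
  ring.
by rewrite mulr0 addr0.
Qed.

Lemma represents_scale a u (f : V) : represents rho u f ->
  represents rho (fun x => a * u x) (a *: f).
Proof.
move=> uf; have := represents_lin a uf represents0; rewrite addr0.
by under eq_fun do rewrite addr0.
Qed.

Lemma represents_sum (I : Type) (r : seq I) (P : pred I) (u : I -> R -> R) (f : I -> V) :
  (forall l, P l -> represents rho (u l) (f l)) ->
  represents rho (fun x => \sum_(l <- r | P l) u l x) (\sum_(l <- r | P l) f l).
Proof.
move=> uf; elim: r => [|l r IHr].
  by rewrite big_nil; under eq_fun do rewrite big_nil; exact: represents0.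
rewrite big_cons; under eq_fun do rewrite big_cons.
case: ifPn => // Pl; have := represents_lin 1 (uf l Pl) IHr.
by rewrite scale1r; under eq_fun do rewrite mul1r.
Qed.

Lemma represents_sub u (f : V) v (g : V) : represents rho u f -> represents rho v g ->
  represents rho (fun x => u x - v x) (f - g).
Proof.
move=> uf vg; have := represents_lin (-1) vg uf; rewrite scaleN1r addrC.
by under eq_fun do rewrite mulN1r addrC.
Qed.

End one_weight.

Lemma represents_series_remainder (mu nu : R -> R) (A : (R -> R) -> R -> R)
    (I : set nat) (c : nat -> R) (s r : nat -> R -> R) (s' r' : nat -> V) n u f g :
  borel_weight mu ->
  (forall l, I l -> represents nu (s l) (s' l)) ->
  (forall l, I l -> represents mu (r l) (r' l)) ->
  represents mu u f -> represents nu (A u) g ->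
  represents nu
    (fun x => A u x - \sum_(0 <= l < n | l \in I) c l * rank_one mu (s l) (r l) u x)
    (g - \sum_(0 <= l < n | l \in I) (c l * ip (r' l) f) *: s' l).
Proof.
move=> muW ss rr uf Ag; apply: represents_sub => //; apply: represents_sum => l.
rewrite inE => Il; rewrite -(represents_inner muW (rr l Il) uf).
have := represents_scale (c l * inner mu (r l) u) (ss l Il).
by under [in X in X -> _]eq_fun do rewrite -mulrA.
Qed.

End weighted_L2.

#[local] Instance ae_lebesgue2_filter (R : realType) :
  Filter (nbhs (almost_everywhere (@lebesgue_measure R \x @lebesgue_measure R)%E)).
Proof.
exact: (@ae_filter_ringOfSetsType _ _ _ (@lebesgue_measure R \x @lebesgue_measure R)%E).
Qed.

(** * The operators as integral operators on the unweighted space *)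

Section kernel_transport.
Context (R : realType).

Notation leb := (@lebesgue_measure R).
Notation D := (`[0%R, 1%R]%classic : set R).
Notation V := (L2fun leb).
Notation VV := (L2fun (leb \x leb)%E).

(** Vanishing off the square is required at every point, so that values of [kop K] vanish exactly
    outside [0, 1]. *)
Definition represents_kernel (p : R -> R -> R) (mu nu : R -> R) (K : VV) : Prop :=
  {ae (leb \x leb)%E, forall z, D z.1 -> D z.2 ->
     K z = p z.1 z.2 * Num.sqrt (mu z.1) / Num.sqrt (nu z.2)} /\
  (forall z, ~ (D z.1 /\ D z.2) -> K z = 0).

Context (p : R -> R -> R) (mu nu : R -> R) (K : VV).
Hypotheses (muW : borel_weight mu) (nuW : borel_weight nu).
Hypothesis Kp : represents_kernel p mu nu K.

Lemma kernel_op_out (K' : VV) (f : V) y :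
  (forall x, K' (x, y) = 0) -> kernel_op leb K' f y = 0.
Proof.
move=> K0; rewrite /kernel_op /Rintegral (_ : (fun x => _) = cst 0%E) ?integral0 //.
by apply/funext => x; rewrite K0 mul0r.
Qed.

(** The factor sqrt(nu) / nu = 1 / sqrt(nu) and the splitting of mu into two square roots, one for
    the kernel and one for [u], produce exactly [K]. *)
Lemma represents_transfer u (f : V) : represents mu u f ->
  represents nu
    (fun y => (nu y)^-1 * \int[leb]_(x in D) (p x y * mu x * u x)) (kop K f).
Proof.
move=> uf; have [Kae K0] := Kp.
apply: filterS2 (kernel_section_L2 K) (ae_sections2 Kae) => y [k kE] Ky.
rewrite patchE kopE; case: ifPn => [/set_mem Dy|]; last first.
  rewrite notin_setE => Dy; rewrite kernel_op_out // => x.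
  by apply: K0 => -[].
have nuy0 : 0 < Num.sqrt (nu y) by rewrite sqrtr_gt0; exact: nuW.2.
suff -> : \int[leb]_(x in D) (p x y * mu x * u x) =
    Num.sqrt (nu y) * kernel_op leb K f y.
  by rewrite -{1}(sqrt_weight nuW Dy); field; rewrite gt_eqF.
rewrite /kernel_op (_ : \int[leb]_x _ = \int[leb]_x (k x * f x)); last first.
  by rewrite kE.
rewrite -RintegralZl //; last exact: L2_integrableM.
apply: ae_eq_Rintegral_any; apply: filterS2 uf Ky => x <- Kx.
rewrite kE !patchE; case: ifPn => [/set_mem Dx|_]; last by rewrite !mulr0.
rewrite Kx // -{1}(sqrt_weight muW Dx) /=; field; rewrite gt_eqF //.
Qed.

Lemma represents_pullback v (g : V) : represents nu v g ->
  represents mu (fun x => \int[leb]_(y in D) (p x y * v y)) (kop (kswap K) g).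
Proof.
move=> vg; have [Kae K0] := Kp.
apply: filterS2 (kernel_section_L2 (kswap K)) (ae_sections1 Kae) => x [k kE] Kx.
rewrite patchE kopE; case: ifPn => [/set_mem Dx|]; last first.
  rewrite notin_setE => Dx; rewrite kernel_op_out // => y.
  by rewrite kswapE; apply: K0 => -[].
have mux0 : 0 < Num.sqrt (mu x) by rewrite sqrtr_gt0; exact: muW.2.
suff -> : \int[leb]_(y in D) (p x y * v y) =
    (Num.sqrt (mu x))^-1 * kernel_op leb (kswap K) g x.
  by field; rewrite gt_eqF.
rewrite /kernel_op (_ : \int[leb]_y _ = \int[leb]_y (k y * g y)); last first.
  by rewrite kE.
rewrite -RintegralZl //; last exact: L2_integrableM.
apply: ae_eq_Rintegral_any; apply: filterS2 vg Kx => y <- Ky.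
rewrite kE !patchE; case: ifPn => [/set_mem Dy|_]; last by rewrite !mulr0.
have nuy0 : 0 < Num.sqrt (nu y) by rewrite sqrtr_gt0; exact: nuW.2.
by rewrite kswapE /= Ky //=; field; rewrite !gt_eqF.
Qed.

End kernel_transport.

(** * Borel versions of the data and square integrability of the kernel *)

Section graphon_kernel.
Context (R : realType) (w : R -> R -> R) (d0 : R) (mu : R -> R).

Notation leb := (@lebesgue_measure R).
Notation D := (`[0%R, 1%R]%classic : set R).
Notation V := (L2fun leb).
Notation VV := (L2fun (leb \x leb)%E).
Notation MR := (measurableTypeR R).

Hypotheses (w_graphon : graphon w) (d0_gt0 : 0 < d0).
Hypothesis out_degree_ge : forall x, D x -> d0 <= out_degree w x.
Hypothesis mu_density : probability_density mu.
Hypothesis mu_gt0 : forall x, D x -> 0 < mu x.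
Hypothesis nu_gt0 : forall x, D x -> 0 < image_density w mu x.

Lemma borel_weight_mu : borel_weight mu.
Proof.
split=> //; have [cmu _ _] := mu_density.
have [mu' [mmu' muE _]] := completed_borel_version (@measurable_unitI R) cmu.
by exists mu'; split.
Qed.

Lemma borel_graphon : exists w' : MR * MR -> R,
  [/\ measurable_fun setT w', (forall z, 0 <= w' z <= 1),
      (forall z, ~ (D z.1 /\ D z.2) -> w' z = 0) &
      {ae (leb \x leb)%E, forall z, D z.1 -> D z.2 -> w z.1 z.2 = w' z}].
Proof.
have [cw w01] := w_graphon.
have mDD : measurable (D `*` D : set (MR * MR)).
  by apply: measurableX; exact: measurable_unitI.
have [w1 [mw1 w1E w10]] := completed_borel_version mDD cw.
(* Clamping makes the bounds hold at every point, not just almost everywhere. *)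
exists (fun z => Num.max 0 (Num.min 1 (w1 z))); split.
- by apply: measurable_maxr => //; exact: measurable_minr.
- move=> z; rewrite le_max lexx /= ge_max ler01 /= ge_min lexx //.
- move=> z nD; rewrite w10 //.
  by rewrite min_r // maxxx.
- apply: filterS w1E => z wz D1 D2; rewrite -wz //.
  have /andP[w0 w1'] := w01 z.1 z.2 (mem_set D1) (mem_set D2).
  by rewrite min_r // max_r.
Qed.

Lemma graphon_kernel : borel_weight (image_density w mu) /\
  exists K : VV, represents_kernel (transition_density w) mu (image_density w mu) K.
Proof.
have [w' [mw' w'01 w'0 w'E]] := borel_graphon.
have [cmu mu0 mu1] := mu_density.
have [mu1' [mmu1' mu1'E mu1'0]] := completed_borel_version (@measurable_unitI R) cmu.
pose mu' : MR -> R := fun x => Num.max 0 (mu1' x).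
have mmu' : measurable_fun setT mu' by apply: measurable_maxr.
have mu'0 x : 0 <= mu' x by rewrite /mu' le_max lexx.
have mu'E : {ae leb, forall x, (mu \_ D) x = mu' x}.
  apply: filterS mu1'E => x mux; rewrite patchE; case: ifPn => [/set_mem Dx|].
    by rewrite /mu' -mux // max_r // ltW // mu_gt0.
  by rewrite notin_setE => Dx; rewrite /mu' mu1'0 // maxxx.
pose d' : MR -> R := fun x => \int[leb]_y w' (x, y).
have md' : measurable_fun setT d'.
  apply: (measurable_Rintegral1 leb (F := fun z => w' (z.2, z.1))).
  apply: measurableT_comp => //.
  by apply/measurable_fun_pairP; split; [exact: measurable_snd|exact: measurable_fst].
have d'E : {ae leb, forall x, D x -> out_degree w x = d' x}.
  apply: filterS (ae_sections1 w'E) => x wx Dx; apply: ae_eq_Rintegral_any.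
  apply: filterS wx => y wxy; rewrite patchE; case: ifPn => [/set_mem Dy|].
    exact: wxy.
  by rewrite notin_setE => Dy; rewrite w'0 // => -[].
(* Truncating below at [d0] keeps the bound on [p'] valid everywhere and changes [d'] on [0, 1] only
   on a null set. *)
pose e' : MR -> R := fun x => Num.max d0 (d' x).
have e'0 x : d0 <= e' x by rewrite /e' le_max lexx.
have e'_gt0 x : 0 < e' x by exact: lt_le_trans (e'0 x).
pose p' : MR * MR -> R := fun z => w' z * (e' z.1)^-1.
have me' : measurable_fun setT e' by apply: measurable_maxr.
have mp' : measurable_fun setT p'.
  apply: measurable_funM => //; apply: measurable_funV_ge0 => [|z]; last exact: ltW.
  exact: measurableT_comp.
have p'0 z : 0 <= p' z.
  by have /andP[w0 _] := w'01 z; rewrite /p' mulr_ge0 // invr_ge0 ltW.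
have p'le z : p' z <= d0^-1.
  have /andP[w0 w1] := w'01 z; rewrite /p' -[leRHS]mul1r ler_pM //.
    by rewrite invr_ge0 ltW.
  by rewrite lef_pV2 ?posrE.
have p'out z : ~ (D z.1 /\ D z.2) -> p' z = 0 by move=> nD; rewrite /p' w'0 // mul0r.
have p'E : {ae (leb \x leb)%E, forall z, D z.1 -> D z.2 ->
    transition_density w z.1 z.2 = p' z}.
  apply: filterS2 w'E (ae_fst d'E) => z wz dz D1 D2.
  rewrite /transition_density /p' wz // /e' -dz // max_r //; exact: out_degree_ge.
pose nu' : MR -> R := fun y => \int[leb]_x (p' (x, y) * mu' x).
have mpmu : measurable_fun setT (fun z => p' z * mu' z.1).
  by apply: measurable_funM => //; exact: measurableT_comp.
have mnu' : measurable_fun setT nu' by exact: (measurable_Rintegral1 leb mpmu).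
have nu'0 y : 0 <= nu' y by apply: Rintegral_ge0 => x _; rewrite mulr_ge0.
have nu'E : {ae leb, forall y, D y -> image_density w mu y = nu' y}.
  apply: filterS (ae_sections2 p'E) => y py Dy; apply: ae_eq_Rintegral_any.
  apply: filterS2 py mu'E => x pxy <-; rewrite !patchE.
  case: ifPn => [/set_mem Dx|_]; last by rewrite mulr0.
  by rewrite -pxy.
have imu' : leb.-integrable setT (EFin \o mu').
  apply/integrableP; split; first exact/measurable_EFinP.
  have -> : (\int[leb]_x `|(EFin \o mu') x| = \int[leb]_(x in D) (mu x)%:E)%E.
    rewrite [RHS]integral_mkcond; apply/esym/ae_eq_integral_any.
    apply: filterS mu'E => x mux _; rewrite /= ger0_norm // -mux !patchE.
    by case: ifPn.
  by rewrite mu1 ltry.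
have ipmu y : leb.-integrable setT (fun x => (p' (x, y) * mu' x)%:E).
  apply: (le_integrable measurableT _ _ (integrableZl measurableT d0^-1 imu')).
    by apply/measurable_EFinP; exact: (measurable_section1 y mpmu).
  move=> x _ /=; rewrite lee_fin normrM [leRHS]normrM ler_pM //.
  by rewrite !ger0_norm // invr_ge0 ltW.
split.
  by split=> //; exists nu'; split.
pose K z := p' z * Num.sqrt (mu' z.1) * (Num.sqrt (nu' z.2))^-1.
have mK : measurable_fun setT K.
  apply: measurable_funM.
    apply: measurable_funM => //; apply: measurable_fun_sqrt.
    exact: measurableT_comp.
  apply: measurable_funV_ge0 => [|z]; last exact: sqrtr_ge0.
  by apply: measurable_fun_sqrt; exact: measurableT_comp.
have mK2 : measurable_fun setT (fun z => (K z ^+ 2)%:E).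
  by apply/measurable_EFinP; exact: measurable_funX.
have K2 : (\int[(leb \x leb)%E]_z (K z ^+ 2)%:E < +oo)%E.
  rewrite fubini_tonelli2 //; last by move=> z; rewrite lee_fin sqr_ge0.
  apply: (@le_lt_trans _ _ (\int[leb]_y (d0^-1 * \1_(D : set MR) y)%:E)%E).
    apply: ge0_le_integral => //.
    - by move=> y _; apply: integral_ge0 => x _; rewrite lee_fin sqr_ge0.
    - apply: measurable_fun_fubini_tonelli_G => //.
      by move=> z; rewrite lee_fin sqr_ge0.
    - by apply/measurable_EFinP; exact: measurable_funM.
    move=> y _; rewrite /fubini_G indicE; case: (boolP (y \in D)) => [/set_mem Dy|]; last first.
      rewrite notin_setE => Dy; rewrite mulr0 (_ : (fun x => _) = cst 0%E) ?integral0 //.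
      by apply/funext => x; rewrite /K p'out ?mul0r ?expr0n // => -[].
    rewrite mulr1.
    apply: (@le_trans _ _ (\int[leb]_x ((d0^-1 * (nu' y)^-1)%:E * (p' (x, y) * mu' x)%:E))%E).
      apply: ge0_le_integral => //.
      - by move=> x _; rewrite lee_fin sqr_ge0.
      - by apply/measurable_EFinP; apply: measurable_funX; exact: (measurable_section1 y mK).
      - by apply/measurable_EFinP; apply: measurable_funM => //; exact: (measurable_section1 y mpmu).
      move=> x _; rewrite -EFinM lee_fin.
      have -> : K (x, y) ^+ 2 = p' (x, y) * (p' (x, y) * mu' x / nu' y).
        rewrite -[in RHS](sqr_sqrtr (mu'0 x)) -[in RHS](sqr_sqrtr (nu'0 y)).
        rewrite -[K (x, y)]/(p' (x, y) * Num.sqrt (mu' x) * (Num.sqrt (nu' y))^-1).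
        rewrite -exprVn; ring.
      rewrite (_ : d0^-1 / nu' y * (p' (x, y) * mu' x) =
        d0^-1 * (p' (x, y) * mu' x / nu' y)); last by ring.
      by apply: ler_wpM2r; [rewrite mulr_ge0 ?invr_ge0 // mulr_ge0|exact: p'le].
    rewrite integralZl // -[X in (_ * X)%E]fineK ?integrable_fin_num //.
    rewrite -EFinM lee_fin -[fine _]/(nu' y) -mulrA.
    apply: ler_piMr; first by rewrite invr_ge0 ltW.
    (* The Borel version [nu'] may vanish at some points; there the convention 0^-1 = 0 gives the
       bound. *)
    have [->|nz] := eqVneq (nu' y) 0; first by rewrite mulr0.
    by rewrite mulVf.
  under eq_integral do rewrite EFinM.
  rewrite ge0_integralZl //; last 2 first.
  - by apply/measurable_EFinP; exact: measurable_indic.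
  - by rewrite lee_fin invr_ge0 ltW.
  rewrite integral_indic //.
  rewrite setIT /= lebesgue_measure_itv /= lte_fin ltr01 -EFinB -EFinM ltry //.
have [K' K'E] := @L2_mk _ _ _ (leb \x leb)%E K mK K2.
exists K'; split; last by move=> z nD; rewrite K'E /K p'out // !mul0r.
apply: filterS3 p'E (ae_fst mu'E) (ae_snd nu'E) => z pz muz nuz D1 D2.
by rewrite K'E /K pz // nuz // -muz patchT ?inE.
Qed.

End graphon_kernel.

(** * Transport of the spectral decomposition *)

Section spectral_transport.
Context (R : realType) (p : R -> R -> R) (mu nu : R -> R).

Notation leb := (@lebesgue_measure R).
Notation D := (`[0%R, 1%R]%classic : set R).
Notation V := (L2fun leb).
Notation VV := (L2fun (leb \x leb)%E).
Notation ip := (L2ip leb).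
Notation ip2 := (L2ip (leb \x leb)%E).

Context (K : VV) (T F : (R -> R) -> R -> R).
Hypotheses (muW : borel_weight mu) (nuW : borel_weight nu).
Hypothesis Kp : represents_kernel p mu nu K.

Let A : V -> V := gram (kop K) (kop (kswap K)).

Hypothesis repT : forall u (f : V), represents mu u f -> represents nu (T u) (kop K f).
Hypothesis repF : forall u (f : V), represents mu u f -> represents mu (F u) (A f).

Let H : semi_inner (fun f g : V => ip f g) := L2ip_semi_inner leb.
Let H2 : semi_inner (fun f g : VV => ip2 f g) := L2ip_semi_inner _.
Let adj : forall f g : V, ip (kop K f) g = ip f (kop (kswap K) g) := kop_adjoint K.

Lemma transport_spectral_theorem : exists (I : set nat) (lambda : nat -> R)
  (phi : nat -> R -> R), eigendecomposition mu F I lambda phi.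
Proof.
have [lambda [f [_ fON fA fle]]] := spectral_decomposition H H adj
  (fun r e ru eON => kop_hilbert_schmidt K ru eON) (@L2_rate_complete _ _ _ leb).
pose I := [set l | lambda l != 0].
pose phi l x := f l x / Num.sqrt (mu x).
have rphi l : I l -> represents mu (phi l) (f l).
  move=> Il; apply: (represents_quotient muW).
  (* Off [0, 1] the kernel, and hence [lambda l * f l], is zero; as the eigenvalue is nonzero, [f l]
     vanishes there and comes from a function on [0, 1]. *)
  have := L2_weak_eq_ae (fA l); apply: filterS => x E Dx.
  have : lambda l * f l x = 0.
    rewrite -[LHS](E Logic.I) /gram kopE kernel_op_out // => y.
    by rewrite kswapE Kp.2 // => -[].
  by move/eqP; rewrite mulf_eq0 (negPf Il) => /eqP.
exists I, lambda, phi; split.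
- split=> [l Il|k l Ik Il]; first exact: represents_L2 (rphi l Il).
  by rewrite (represents_inner muW (rphi k Ik) (rphi l Il)) fON.
- by move=> l Il.
- move=> l Il.
  apply/(represents_ae muW (repF (rphi l Il)) (represents_scale (lambda l) (rphi l Il))).
  exact: L2_weak_eq_ae (fA l).
- split=> [u Lu|eps eps0].
    by have [g ug] := L2_represents muW Lu; exact: represents_L2 (repF ug).
  have [n0 n0P] : exists n0, forall n, (n0 <= n)%N -> ip2 K K / n.+1%:R <= eps.
    exists (Num.bound (ip2 K K / eps)) => n n0n.
    rewrite ler_pdivrMr // mulrC -ler_pdivrMr //.
    rewrite (le_trans (ltW (archi_boundP _))) ?divr_ge0 ?(ip_ge0 H2) ?(ltW eps0) //.
    by rewrite ler_nat (leq_trans n0n).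
  exists n0 => // n /= n0n u Lu; have [g ug] := L2_represents muW Lu.
  have := represents_series_remainder lambda n muW rphi rphi ug (repF ug).
  move/(represents_sqnorm muW) ->; rewrite (represents_sqnorm muW ug) -EFinM lee_fin.
  have PE l : (l \in I) = (lambda l != 0).
    by apply/idP/idP => [/set_mem//|h]; exact: mem_set.
  rewrite (eq_bigl _ _ PE); apply: (le_trans (fle n g)).
  apply: ler_wpM2r; first exact: ip_ge0 H _.
  rewrite ler_sqr ?nnegrE ?n0P ?(ltW eps0) //.
  by rewrite divr_ge0 // (ip_ge0 H2).
Qed.

Section given_eigendecomposition.
Context (I : set nat) (lambda : nat -> R) (phi : nat -> R -> R).
Hypothesis eig : eigendecomposition mu F I lambda phi.

Let P : pred nat := fun l => l \in I.
Let sigma l := Num.sqrt (lambda l).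
Let u l x := (Num.sqrt (lambda l))^-1 * T (phi l) x.

Let eigen_functions : exists f : nat -> V, forall l, I l -> represents mu (phi l) (f l).
Proof.
have [[phiL _] _ _ _] := eig.
have /choice[f fP] : forall l, exists f : V, I l -> represents mu (phi l) f.
  move=> l; have [Il|nIl] := pselect (I l); last by exists 0.
  by have [f fP] := L2_represents muW (phiL l Il); exists f.
by exists f.
Qed.

Section representatives.
Context (f : nat -> V).
Hypothesis fP : forall l, I l -> represents mu (phi l) (f l).

Let fON k l : P k -> P l -> ip (f k) (f l) = (k == l)%:R.
Proof.
move=> /set_mem Ik /set_mem Il; have [[_ phiON] _ _ _] := eig.
by rewrite -phiON // (represents_inner muW (fP Ik) (fP Il)).
Qed.

Let fA l : P l -> weak_eq (fun f g : V => ip f g) (A (f l)) (lambda l *: f l).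
Proof.
move=> /set_mem Il; have [_ _ Fphi _] := eig.
have := Fphi l Il.
move/(represents_ae muW (repF (fP Il)) (represents_scale (lambda l) (fP Il))).
by move=> E h; exact: L2ip_ae_eq.
Qed.

(** An eigendecomposition only provides nonzero eigenvalues; the sign comes from <A f, f> = |T
    f|^2. *)
Let lambda_gt0 l : P l -> 0 < lambda l.
Proof.
move=> Pl; have [_ lam0 _ _] := eig.
by rewrite lt_def lam0 ?(eigenvalue_ge0 H H adj fON fA) //; exact: set_mem.
Qed.

Let repu l : I l -> represents nu (u l) ((sigma l)^-1 *: kop K (f l)).
Proof. by move=> Il; apply: represents_scale; exact: repT (fP Il). Qed.

Let remainder_le (eps : R) : 0 < eps -> exists n0, forall n, (n0 <= n)%N ->
  forall v (g : V), represents mu v g ->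
  ip (kop K g - \sum_(0 <= l < n | P l) ip (f l) g *: kop K (f l))
     (kop K g - \sum_(0 <= l < n | P l) ip (f l) g *: kop K (f l)) <= eps * ip g g.
Proof.
move=> eps0; have [_ _ _ [_ /(_ eps eps0)[n0 _ n0P]]] := eig.
exists n0 => n n0n v g vg; apply: (svd_remainder_le H H adj fON fA (ltW eps0)).
have := n0P n n0n v (represents_L2 muW vg).
have := represents_series_remainder lambda n muW fP fP vg (repF vg).
by move/(represents_sqnorm muW) ->; rewrite (represents_sqnorm muW vg) -EFinM lee_fin.
Qed.

Lemma transport_svd : singular_value_decomposition mu nu T I sigma u phi.
Proof.
have [phiON _ _ _] := eig; split=> //.
- split=> [l Il|k l Ik Il]; first exact: represents_L2 (repu Il).
  have Pk : P k by exact: mem_set. have Pl : P l by exact: mem_set.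
  rewrite (represents_inner nuW (repu Ik) (repu Il)) (ipZl H) (ipZr H).
  rewrite (gram_form_eigen H H adj fON fA Pk Pl).
  have [<-|_] := eqVneq k l; last by rewrite !mulr0.
  rewrite mulr1 mulrA -invfM -expr2 sqr_sqrtr ?ltW ?lambda_gt0 //.
  by rewrite mulVf // gt_eqF // lambda_gt0.
- by move=> l Il; rewrite sqrtr_gt0 lambda_gt0 //; exact: mem_set.
- split=> [v Lv|eps eps0].
    by have [g vg] := L2_represents muW Lv; exact: represents_L2 (repT vg).
  (* An operator norm bound eps^2 for the remainder of [F] is a squared norm bound eps^2 for that of
     [T]. *)
  have [n0 n0P] := remainder_le (exprn_gt0 2 eps0).
  exists n0 => // n /= n0n v Lv; have [g vg] := L2_represents muW Lv.
  have := represents_series_remainder sigma n muW repu fP vg (repT vg).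
  move/(represents_sqnorm nuW) ->; rewrite (represents_sqnorm muW vg) -EFinM lee_fin.
  rewrite (eq_bigr (fun l => ip (f l) g *: kop K (f l))); first exact: n0P n0n _ _ vg.
  move=> l Pl; rewrite scalerA mulrAC mulfV ?mul1r //.
  by rewrite gt_eqF // sqrtr_gt0 lambda_gt0.
Qed.

Let sum_apply (r : seq nat) (Q : pred nat) (G : nat -> VV) z :
  (\sum_(l <- r | Q l) G l) z = \sum_(l <- r | Q l) G l z.
Proof. by elim/big_rec2: _ => [//|l x y _ <-]. Qed.

(** [remainder_le] covers only vectors supported in [0, 1]. Cutting [g] off there changes neither
    [kop K g] nor its coefficients, since [K] and the [f l] live on [0, 1]. *)
Let kernel_limit (g : V) (eps : R) : 0 < eps -> exists N, forall n, (N <= n)%N ->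
  let h : V := kop K g - \sum_(0 <= l < n | P l) ip (f l) g *: kop K (f l) in
  ip h h <= eps.
Proof.
move=> eps0; have mg : measurable_fun setT g by exact: L2_measurable.
have mD : measurable (D : set (measurableTypeR R)) := @measurable_unitI R.
have [||gD gDE] := @L2_mk _ _ _ leb (g \_ D).
- exact/(measurable_restrictT _ mD)/measurable_funTS.
- apply: (@le_lt_trans _ _ (\int[leb]_x (g x ^+ 2)%:E)%E); last by rewrite L2sqnormE ltry.
  apply: ge0_le_integral => //.
  + by move=> x _; rewrite lee_fin sqr_ge0.
  + apply/measurable_EFinP; apply: measurable_funX.
    exact/(measurable_restrictT _ mD)/measurable_funTS.
  + by apply/measurable_EFinP; apply: measurable_funX.
  + move=> x _; rewrite lee_fin patchE; case: ifP => // _.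
    by rewrite expr0n sqr_ge0.
have kopD : kop K g = kop K gD.
  apply/LfuneqP => y; rewrite !kopE; apply: eq_Rintegral => x _.
  rewrite gDE patchE; case: ifPn => //; rewrite notin_setE => nDx.
  by rewrite Kp.2 ?mul0r // => -[].
have ipD l : P l -> ip (f l) g = ip (f l) gD.
  move=> /set_mem Il; rewrite /L2ip /Rintegral; congr fine.
  apply: ae_eq_integral_any; apply: filterS (fP Il) => x <- _.
  rewrite gDE !patchE; case: ifPn => // _.
  by rewrite !mul0r.
have vg : represents mu (fun x => gD x / Num.sqrt (mu x)) gD.
  apply: represents_quotient => //; apply: nearW => x nDx.
  by rewrite gDE patchN // notin_setE.
have c0 : 0 < ip gD gD + 1 by rewrite ltr_wpDl // (ip_ge0 H).
have [n0 n0P] := remainder_le (divr_gt0 eps0 c0).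
exists n0 => n n0n /=; rewrite kopD (eq_bigr (fun l => ip (f l) gD *: kop K (f l))).
  apply: le_trans (n0P n n0n _ _ vg) _.
  by rewrite -mulrA ler_piMr ?(ltW eps0) // mulrC ler_pdivrMr // mul1r lerDl.
by move=> l /ipD ->.
Qed.

Lemma transport_kernel_series : kernel_series mu nu p I sigma u phi.
Proof.
pose rem n := kernel_remainder K [seq l <- iota 0 n | P l] f.
have remE n z : rem n z = K z - \sum_(0 <= l < n | P l) f l z.1 * kop K (f l) z.2.
  rewrite /rem /kernel_remainder big_filter /index_iota subn0.
  rewrite -[LHS]/(K z - (\sum_(l <- iota 0 n | P l) tensor (f l) (kop K (f l))) z).
  by rewrite sum_apply; congr (_ - _); apply: eq_bigr => l _; rewrite tensorE.
have intE n : (\int[(leb \x leb)%E]_(z in D `*` D)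
     ((p z.1 z.2 - \sum_(0 <= l < n | l \in I)
          sigma l * phi l z.1 * u l z.2 * nu z.2) ^+ 2 * (mu z.1 / nu z.2))%:E)%E =
    (ip2 (rem n) (rem n))%:E.
  (* On the square the kernel remainder is the bracket times sqrt(mu) / sqrt(nu), because
     [sigma l * u l] is [T (phi l)]; squaring gives the weight mu / nu. Off the square both
     integrands vanish. *)
  rewrite -L2sqnormE [LHS]integral_mkcond; apply: ae_eq_integral_any.
  have aef : {ae leb, forall x, forall l, I l ->
      ((fun x => phi l x * Num.sqrt (mu x)) \_ D) x = f l x}.
    apply: ae_foralln => l; have [Il|nIl] := pselect (I l); last exact: nearW.
    by apply: filterS (fP Il) => x E _.
  have aeT : {ae leb, forall y, forall l, I l ->
      ((fun y => T (phi l) y * Num.sqrt (nu y)) \_ D) y = kop K (f l) y}.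
    apply: ae_foralln => l; have [Il|nIl] := pselect (I l); last exact: nearW.
    by apply: filterS (repT (fP Il)) => x E _.
  apply: filterS3 Kp.1 (ae_fst aef) (ae_snd aeT) => z Kz fz Tz _.
  rewrite remE patchE; case: ifPn => [/set_mem[D1 D2]|].
    have a0 : 0 < Num.sqrt (mu z.1) by rewrite sqrtr_gt0; exact: muW.2.
    have b0 : 0 < Num.sqrt (nu z.2) by rewrite sqrtr_gt0; exact: nuW.2.
    have muE := sqrt_weight muW D1; have nuE := sqrt_weight nuW D2.
    congr EFin; rewrite Kz //.
    have -> : \sum_(0 <= l < n | P l) f l z.1 * kop K (f l) z.2 =
        (\sum_(0 <= l < n | l \in I) sigma l * phi l z.1 * u l z.2 * nu z.2) *
        Num.sqrt (mu z.1) / Num.sqrt (nu z.2).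
      rewrite -mulrA mulr_suml; apply: eq_bigr => l Pl.
      have Il : I l by exact: set_mem.
      rewrite -fz // -Tz // !patchT ?inE // /u -/(sigma l).
      have s0 : sigma l != 0 by rewrite gt_eqF // sqrtr_gt0 lambda_gt0.
      move: (sigma l) s0 (Num.sqrt (nu z.2)) nuE b0 => s s0 b <- b0.
      by field; rewrite s0 gt_eqF.
    rewrite -!mulrBl exprMn exprMn exprVn !expr2 muE nuE; ring.
  rewrite notin_setE => nD; congr EFin.
  rewrite Kp.2 // big1 ?subr0 ?expr0n // => l Pl.
  have Il : I l by exact: set_mem.
  rewrite -fz // -Tz // !patchE.
  case: ifPn => [/set_mem D1|_]; last by rewrite mul0r.
  case: ifPn => [/set_mem D2|_]; last by rewrite mulr0.
  by case: nD.
rewrite /kernel_series (_ : (fun n => _) = EFin \o (fun n => ip2 (rem n) (rem n))).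
  apply: cvg_EFin; first exact: nearW.
  apply/cvgrPdist_le => eps eps0.
  have [N HN] := kernel_expansion fON kernel_limit eps0.
  exists N => // n /= Nn; rewrite sub0r normrN ger0_norm; last exact: (ip_ge0 H2 (rem n)).
  exact: HN.
by apply/funext => n; exact: intE.
Qed.

End representatives.

Lemma transport_conclusion :
  singular_value_decomposition mu nu T I sigma u phi /\
  kernel_series mu nu p I sigma u phi.
Proof.
have [f fP] := eigen_functions.
by split; [exact: transport_svd fP|exact: transport_kernel_series fP].
Qed.

End given_eigendecomposition.
End spectral_transport.

Theorem mainTheorem2 (R : realType) (w : R -> R -> R) (d0 : R) (mu : R -> R)
  (w_graphon : graphon w)
  (d0_gt0 : 0 < d0)
  (out_degree_ge : forall x : R, x \in `[0, 1] -> d0 <= out_degree w x)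
  (mu_density : probability_density mu)
  (mu_gt0 : forall x : R, x \in `[0, 1] -> 0 < mu x)
  (nu_gt0 : forall x : R, x \in `[0, 1] -> 0 < image_density w mu x) :
  let p := transition_density w in
  let nu := image_density w mu in
  let T := perron_frobenius w mu in
  let F := forward_backward w mu in
  (exists (I : set nat) (lambda : nat -> R) (phi : nat -> R -> R),
     eigendecomposition mu F I lambda phi) /\
  (forall (I : set nat) (lambda : nat -> R) (phi : nat -> R -> R),
     eigendecomposition mu F I lambda phi ->
     let sigma := fun l => Num.sqrt (lambda l) in
     let u := fun l x => (Num.sqrt (lambda l))^-1 * T (phi l) x in
     let v := phi in
     singular_value_decomposition mu nu T I sigma u v /\
     kernel_series mu nu p I sigma u v).
Proof.
move=> p nu T F.
have muW := borel_weight_mu mu_density mu_gt0.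
have [nuW [K Kp]] := graphon_kernel w_graphon d0_gt0 out_degree_ge mu_density mu_gt0 nu_gt0.
have repT u (f : L2fun (@lebesgue_measure R)) :
    represents mu u f -> represents nu (T u) (kop K f).
  exact: represents_transfer muW nuW Kp u f.
have repF u (f : L2fun (@lebesgue_measure R)) : represents mu u f ->
    represents mu (F u) (gram (kop K) (kop (kswap K)) f).
  by move=> /repT; exact: represents_pullback muW nuW Kp _ _.
split; first exact: transport_spectral_theorem muW Kp repF.
move=> I lambda phi eig. exact: (transport_conclusion muW nuW Kp repT repF eig).
Qed.
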